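(* Let $n,m\ge1$ be integers, $1<p_i<\infty$ for $i=1,\dots,m$, $\frac1p=\frac1{p_1}+\cdots+\frac1{p_m}$, $\vec P=(p_1,\dots,p_m)$, $0<\alpha<mn$, $\frac1m<p<\frac n\alpha$ and $\frac1q=\frac1p-\frac\alpha n$. Then there is a constant $C_{n,m,\vec P,q}$ such that for every $\vec\omega=(\omega_1,\dots,\omega_m)\in A_{(\vec P,q)}$ and all $\vec f=(f_1,\dots,f_m)$, $$\|\mathcal M_\alpha(\vec f)\|_{L^q(\nu_{\vec\omega}^q)}\le C_{n,m,\vec P,q}\,[\vec\omega]_{A_{(\vec P,q)}}^{1/q}\prod_{i=1}^m[\sigma_i]_{A_\infty}^{1/p_i}\prod_{i=1}^m\|f_i\|_{L^{p_i}(\omega_i^{p_i})},$$ where $\nu_{\vec\omega}=\prod_{i=1}^m\omega_i$ and $\sigma_i=\omega_i^{-p_i'}$ for $i=1,\dots,m$.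
   Context: Cubes have sides parallel to the axes. A weight is a nonnegative locally integrable function, positive a.e.; $L^r(w)$ is taken with respect to $w\,dx$; $r'$ is the conjugate exponent of $r$. Multilinear fractional maximal operator: for $0\le\alpha<mn$, $$\mathcal M_\alpha(\vec f)(x)=\sup_{Q\ni x}\prod_{i=1}^m\frac1{|Q|^{1-\frac{\alpha}{mn}}}\int_Q|f_i(y_i)|\,dy_i,$$ the supremum over all cubes $Q\subset\mathbb R^n$ containing $x$. Class $A_{(\vec P,q)}$: $\vec\omega\in A_{(\vec P,q)}$ if, with $\nu_{\vec\omega}=\prod_{i=1}^m\omega_i$, $$[\vec\omega]_{A_{(\vec P,q)}}=\sup_Q\Big(\frac1{|Q|}\int_Q\nu_{\vec\omega}^q\Big)\prod_{i=1}^m\Big(\frac1{|Q|}\int_Q\omega_i^{-p_i'}\Big)^{q/p_i'}<\infty .$$ $A_\infty$ constant: $[w]_{A_\infty}=\sup_Q\frac1{w(Q)}\int_Q M(w\chi_Q)\,dx$, with $M$ the Hardy–Littlewood maximal operator and $w(Q)=\int_Q w$. *)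

(* Defs.v *)
From HB Require Import structures.
From mathcomp Require Import all_boot all_order all_algebra.
From mathcomp Require Import all_classical all_reals all_analysis.
Set Implicit Arguments.
Unset Strict Implicit.
Unset Printing Implicit Defensive.
Import Order.TTheory GRing.Theory Num.Theory.
Local Open Scope classical_set_scope.
Local Open Scope ring_scope.

(* The Borel sigma-algebra and Lebesgue measure of R^n, the latter as an
   iterated product; [borel_leb_box] gives its values on boxes. *)

Definition tcons (R : realType) (n : nat)
    (z : measurableTypeR R * n.-tuple (measurableTypeR R)) :
    n.+1.-tuple (measurableTypeR R) :=
  [tuple of z.1 :: z.2].

Fixpoint borel_leb (R : realType) (n : nat) :
    set (n.-tuple (measurableTypeR R)) -> \bar R :=
  match n with
  | 0 => dirac [tuple]
  | n.+1 => pushforward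
      (product_measure1 (@lebesgue_measure R) (@borel_leb R n)) (@tcons R n)
  end.

Section borel_leb_measure.
Context (R : realType).
Local Open Scope ereal_scope.
Local Notation mR := (measurableTypeR R).

Lemma measurable_tcons n : measurable_fun [set: mR * n.-tuple mR] (@tcons R n).
Proof.
apply: (@measurable_cons _ _ _ _ fst n snd).
- exact: measurable_fst.
- exact: measurable_snd.
Qed.

Let tuncons n (x : n.+1.-tuple mR) : mR * n.-tuple mR :=
  (thead x, [tuple of behead x]).

Let tconsK n : cancel (@tcons R n) (@tuncons n).
Proof. by case=> a b; congr pair => //; exact/val_inj. Qed.

Let tunconsK n : cancel (@tuncons n) (@tcons R n).
Proof. by move=> x; rewrite [RHS]tuple_eta; exact/val_inj. Qed.

Let measurable_tuncons n : measurable_fun [set: n.+1.-tuple mR] (@tuncons n).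
Proof.
apply: measurable_fun_pair; first exact: measurable_tnth.
exact: measurable_behead.
Qed.

Let sfm d (T : measurableType d) (m : set T -> \bar R) :=
  [/\ m set0 = 0, forall A, 0 <= m A, semi_sigma_additive m &
      sigma_finite [set: T] m].

Let sfm_pack d (T : measurableType d) (m : set T -> \bar R) : sfm m ->
  exists m' : {sigma_finite_measure set T -> \bar R}, m' = m :> (set T -> \bar R).
Proof.
case=> m0 m1 m2 m3.
pose h1 := isMeasure.Build _ _ _ m m0 m1 m2.
pose M : {measure set T -> \bar R} := HB.pack m h1.
pose h2 := Measure_isSigmaFinite.Build _ _ _ M m3.
pose N : {sigma_finite_measure set T -> \bar R} := HB.pack m h1 h2.
by exists N.
Qed.

Let borel_leb_sfm n : sfm (@borel_leb R n).
Proof.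
elim: n => [|n /sfm_pack[m mE]].
  split => //; first exact: measure_semi_sigma_additive.
  exact: sigma_finiteT.
rewrite /= -mE; have mt := @measurable_tcons n.
split.
- by rewrite /pushforward preimage_set0 measure0.
- by move=> A; exact: measure_ge0.
- move=> A mA tA mUA; rewrite /pushforward preimage_bigcup.
  apply: measure_semi_sigma_additive.
  + by move=> k; rewrite -[X in measurable X]setTI; exact: mt.
  + apply/trivIsetP => /= i j _ _ ij; rewrite -preimage_setI.
    by move/trivIsetP : tA => /(_ _ _ _ _ ij) ->//; rewrite preimage_set0.
  + by rewrite -preimage_bigcup -[X in measurable X]setTI; exact: mt.
have /sigma_finiteP[F [TF ndF Foo]] := sigma_finiteT (@lebesgue_measure R).
have /sigma_finiteP[G [TG ndG Goo]] := sigma_finiteT m.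
exists (fun k => @tuncons n @^-1` (F k `*` G k)).
  rewrite -preimage_bigcup; apply/esym/seteqP; split=> // x _.
  have [k _ Fk] : (\bigcup_k F k) (tuncons x).1 by rewrite -TF.
  have [l _ Gl] : (\bigcup_k G k) (tuncons x).2 by rewrite -TG.
  exists (maxn k l) => //; split.
  - by move: (tuncons x).1 Fk; exact/subsetPset/ndF/leq_maxl.
  - by move: (tuncons x).2 Gl; exact/subsetPset/ndG/leq_maxr.
move=> k; have [mF Fk] := Foo k; have [mG Gk] := Goo k; split.
  rewrite -[X in measurable X]setTI; apply: measurable_tuncons => //.
  exact: measurableX.
rewrite /pushforward -comp_preimage.
rewrite (_ : _ \o _ = id) ?preimage_id//; last first.
  by apply/funext => x; exact: tconsK.
by rewrite product_measure1E// lte_mul_pinfty// ge0_fin_numE.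
Qed.

HB.instance Definition _ n := isMeasure.Build _ _ _ (@borel_leb R n)
  (let: And4 h _ _ _ := borel_leb_sfm n in h)
  (let: And4 _ h _ _ := borel_leb_sfm n in h)
  (let: And4 _ _ h _ := borel_leb_sfm n in h).

HB.instance Definition _ n := Measure_isSigmaFinite.Build _ _ _ (@borel_leb R n)
  (let: And4 _ _ _ h := borel_leb_sfm n in h).

Lemma borel_leb_box n (A : 'I_n -> set mR) : (forall i, measurable (A i)) ->
  borel_leb [set x : n.-tuple mR | forall i, A i (tnth x i)] =
  \prod_(i < n) lebesgue_measure (A i).
Proof.
elim: n A => [|n IHn] A mA.
  rewrite big_ord0 /= diracE.
  by rewrite (_ : _ \in _ = true)//; apply/mem_set => -[].
pose B := [set x : n.-tuple mR | forall i, A (lift ord0 i) (tnth x i)].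
have mB : measurable B.
  rewrite [B](_ : _ = \bigcap_(i in [set: 'I_n])
      (@tnth n mR ^~ i @^-1` A (lift ord0 i))); last first.
    by apply/seteqP; split=> x /= Bx => [i _|i]; exact: Bx.
  apply: fin_bigcap_measurable => [|i _]; first exact: finite_finset.
  by rewrite -[X in measurable X]setTI; exact: measurable_tnth.
rewrite big_ord_recl /= -(IHn (fun i => A (lift ord0 i)))//.
rewrite -[X in _ = _ * X]/(borel_leb B).
rewrite -product_measure1E//; congr product_measure1.
apply/seteqP; split=> -[a b] /=.
  move=> Aab; split; first exact: (Aab ord0).
  by move=> i; have := Aab (lift ord0 i); rewrite /tcons/= tnthS.
move=> [Aa Ab] i; rewrite /tcons.
have [j ->|->] := unliftP ord0 i; first by rewrite tnthS; exact: Ab.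
exact: Aa.
Qed.

End borel_leb_measure.

(* R^n with the Lebesgue sigma-algebra: [euclid R n] is the type of n-tuples of
   reals, its measurable sets are the Caratheodory-measurable ones (hence all
   Lebesgue-null sets are measurable), and [leb] is the complete Lebesgue
   measure. *)
Definition euclid (R : realType) (n : nat) : Type :=
  caratheodory_type (mu_ext (@borel_leb R n)).

Definition leb {R : realType} {n : nat} : set (euclid R n) -> \bar R :=
  @completed_measure_extension _ (n.-tuple (measurableTypeR R)) R (@borel_leb R n).

HB.instance Definition _ (R : realType) (n : nat) := Measure.on (@leb R n).

Definition ecoord (R : realType) (n : nat) (x : euclid R n) (i : 'I_n) : R :=
  tnth (x : n.-tuple R) i.

Lemma leb_box (R : realType) (n : nat) (A : 'I_n -> set (measurableTypeR R)) :
  (forall i, measurable (A i)) ->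
  leb [set x : euclid R n | forall i, A i (ecoord x i)] =
  (\prod_(i < n) lebesgue_measure (A i))%E.
Proof.
move=> mA; rewrite -borel_leb_box// /leb /completed_measure_extension.
rewrite measurable_mu_extE//.
rewrite [X in measurable X](_ : _ = \bigcap_(i in [set: 'I_n])
    (@tnth n (measurableTypeR R) ^~ i @^-1` A i)).
  apply: fin_bigcap_measurable => [|i _]; first exact: finite_finset.
  by rewrite -[X in measurable X]setTI; exact: measurable_tnth.
by apply/seteqP; split=> x /= Bx => [i _|i]; exact: Bx.
Qed.

Section weights.
Context {R : realType} {n : nat}.
Implicit Types (Q : set (euclid R n)) (f w : euclid R n -> R).
Local Open Scope ereal_scope.

(* Nondegenerate closed cubes with sides parallel to the axes. *)
Definition cubes : set (set (euclid R n)) :=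
  [set Q | exists a : euclid R n, exists2 l : R, (0 < l)%R &
    Q = [set x | forall i, (ecoord a i <= ecoord x i <= ecoord a i + l)%R]].

(* Every compact set lies in a cube, so integrability on cubes is local
   integrability. *)
Definition weight w : Prop :=
  [/\ forall x, (0 <= w x)%R,
      {ae (@leb R n), forall x, (0 < w x)%R},
      measurable_fun [set: euclid R n] w &
      forall Q, cubes Q -> (@leb R n).-integrable Q (EFin \o w)].

Definition conj_exp (r : R) : R := (r / (r - 1))%R.

(* The norm of L^r(w), for 0 < r < oo. *)
Definition wnorm (r : R) w (g : euclid R n -> \bar R) : \bar R :=
  (\int[@leb R n]_x (`|g x| `^ r * (w x)%:E)) `^ r^-1.

Definition avg Q (g : euclid R n -> \bar R) : \bar R :=
  (leb Q)^-1 * \int[@leb R n]_(x in Q) g x.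

Definition hl_maximal f (x : euclid R n) : \bar R :=
  ereal_sup [set avg Q (fun y => `|f y|%:E) | Q in [set Q | cubes Q /\ Q x]].

Definition Ainfty_const w : \bar R :=
  ereal_sup [set (\int[@leb R n]_(x in Q) (w x)%:E)^-1 *
                 \int[@leb R n]_(x in Q) hl_maximal (fun y => w y * \1_Q y)%R x
            | Q in cubes].

Definition frac_maximal (m : nat) (alpha : R) (f : 'I_m -> euclid R n -> R)
    (x : euclid R n) : \bar R :=
  ereal_sup [set \prod_(i < m)
      ((leb Q `^ (1 - alpha / (m * n)%:R))^-1 *
       \int[@leb R n]_(y in Q) `|f i y|%:E)
    | Q in [set Q | cubes Q /\ Q x]].

Definition nu (m : nat) (w : 'I_m -> euclid R n -> R) (x : euclid R n) : R :=
  (\prod_(i < m) w i x)%R.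

Definition sigma (m : nat) (P : 'I_m -> R) (w : 'I_m -> euclid R n -> R)
    (i : 'I_m) (x : euclid R n) : R :=
  (w i x `^ (- conj_exp (P i)))%R.

Definition APq_const (m : nat) (P : 'I_m -> R) (q : R)
    (w : 'I_m -> euclid R n -> R) : \bar R :=
  ereal_sup [set avg Q (fun x => (nu w x `^ q)%:E) *
      \prod_(i < m)
        avg Q (fun x => (w i x `^ (- conj_exp (P i)))%:E) `^ (q / conj_exp (P i))
    | Q in cubes].

Definition APq (m : nat) (P : 'I_m -> R) (q : R)
    (w : 'I_m -> euclid R n -> R) : Prop :=
  (forall i, weight (w i)) /\ APq_const P q w < +oo.

End weights.

(* Main.v *)
Require Import Defs.
From mathcomp Require Import all_boot all_order all_algebra.
From mathcomp Require Import all_classical all_reals all_analysis.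
From mathcomp Require Import measurable_realfun ring lra zify.
Set Implicit Arguments.
Unset Strict Implicit.
Unset Printing Implicit Defensive.
Import Order.TTheory GRing.Theory Num.Theory.
Local Open Scope classical_set_scope.
Local Open Scope ring_scope.

(** Why the inequality holds. Write s_i for sigma_i and h(Q) for the integral of
    h over Q. On a single cube the exponents are such that all powers of |Q|
    cancel: since 1/q = 1/p - alpha/n and 1/p is the sum of the 1/P_i, the
    A_(P,q) condition bounds the contribution
      (|Q|^(alpha/n) prod_i |f_i|(Q)/|Q|)^q nu^q(Q)
    of Q to the q-th power of the left-hand side by the constant [w] times
      prod_i ((|f_i|(Q)/s_i(Q))^P_i s_i(Q))^(q/P_i)
    ([testing_le_sum]). If the cubes run over a family that is sparse for
    Lebesgue measure, then for each i the sum over Q of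
    (|f_i|(Q)/s_i(Q))^P_i s_i(Q) is at most a multiple of [s_i]_Ainfty times the
    integral of |f_i|^P_i w_i^P_i: this is the Carleson embedding theorem
    ([carleson_embedding]), whose packing hypothesis comes from the A_infinity
    constant. As q >= p, the weighted arithmetic-geometric mean inequality turns
    the sum of the products into the product of the sums, and taking q-th roots
    gives the claimed powers 1/q and 1/P_i.

    It remains to dominate the maximal operator by a sum over sparse families.
    Every cube lies in a cell of comparable size of one of 2^n dyadic grids,
    obtained from one another by translating coordinates by a third of the
    coarsest side ([cube_sub_dyadic_cell]). Stage N uses the cells of sides
    3*2^N, ..., 3*2^-N only, so that every grid has a coarsest generation; a
    given cube is handled by all sufficiently large N, and Fatou's lemma passes
    to the limit ([frac_maximal_le_liminf]). In one grid, a cell is selected when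
    the mean of some |f_i| exceeds 2m times its mean over the last selected cell
    above it ([stop]). Between two selections all means are controlled by those
    on the selected cell, hence so is the product defining the maximal operator
    ([dyadic_prod_le_stop]); and by the weak type (1,1) inequality the next
    selected cells cover at most half of a selected cell ([stop_sparse]). The
    uncovered parts E_Q of the selected cells Q are disjoint, hence inside a cell
    R the sum of the s_i(Q) is at most twice the sum of |E_Q| s_i(Q)/|Q|, so at
    most twice the integral over R of the maximal function of s_i 1_R, that is,
    at most 2 [s_i]_Ainfty s_i(R) ([stop_packing]).

    The part of the argument that concerns one grid is written for an arbitrary
    sequence of nested countable partitions of a measure space into cells of
    finite positive measure. A partition is given by a function to [nat], and its
    cells are the fibres; a condition on a cell becomes a condition on the points
    of the cell, which makes sums over cells into integrals of functions. *)

(** * Nested partitions and means over their cells *)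

Section nested_partitions.
Context d (T : measurableType d) (R : realType).
Variables (mu : {measure set T -> \bar R}) (iota : nat -> T -> nat).

Definition cell k (x : T) : set T := [set y | iota k y = iota k x].

Record nested_partition := {
  measurable_iota : forall k m, measurable (iota k @^-1` [set m]);
  iota_nested : forall k x y, iota k.+1 x = iota k.+1 y -> iota k x = iota k y;
  mu_cell_gt0 : forall k x, (0 < mu (cell k x))%E;
  mu_cell_lty : forall k x, (mu (cell k x) < +oo)%E }.

Definition cell_constant k (rT : Type) (u : T -> rT) :=
  forall x y, iota k x = iota k y -> u x = u y.

Definition saturated k (D : set T) := forall x y, D x -> iota k x = iota k y -> D y.

Definition vol k (x : T) : R := fine (mu (cell k x)).

(** [locked] keeps lemmas on products from seeing the quotient when they are
    used for rewriting. *)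
Definition mean k (f : T -> R) (x : T) : R :=
  locked (fine (\int[mu]_(y in cell k x) (f y)%:E) / vol k x).

Definition cell_integrable (f : T -> R) :=
  [/\ measurable_fun [set: T] f, forall x, 0 <= f x &
      forall x, (\int[mu]_(y in cell 0 x) (f y)%:E < +oo)%E].

Hypothesis H : nested_partition.

Lemma iota_mono j k x y : (j <= k)%N -> iota k x = iota k y -> iota j x = iota j y.
Proof.
move=> /subnK <-; elim: (k - j)%N => //= i IH e.
by apply: IH; apply: iota_nested.
Qed.

Lemma cell_eq k x y : iota k x = iota k y -> cell k x = cell k y.
Proof. by rewrite /cell => ->. Qed.

Lemma vol_constant k : cell_constant k (vol k).
Proof. by move=> x y e; rewrite /vol (cell_eq e). Qed.

Lemma mean_constant k f : cell_constant k (mean k f).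
Proof. by move=> x y e; rewrite /mean (cell_eq e) (vol_constant e). Qed.

Lemma measurable_cell k x : measurable (cell k x).
Proof. exact: measurable_iota. Qed.
Hint Resolve measurable_cell : core.

Lemma subset_cell j k x : (j <= k)%N -> cell k x `<=` cell j x.
Proof. by move=> jk y /(iota_mono jk). Qed.

Lemma saturated_cell j k x : (j <= k)%N -> saturated k (cell j x).
Proof. by move=> jk y z; rewrite /cell/= => yx /(iota_mono jk) <-. Qed.

Lemma vol_gt0 k x : 0 < vol k x.
Proof. by apply: fine_gt0; rewrite mu_cell_gt0// mu_cell_lty. Qed.

Lemma vol_ge0 k x : 0 <= vol k x.
Proof. exact/ltW/vol_gt0. Qed.

Lemma volE k x : mu (cell k x) = (vol k x)%:E.
Proof.
by rewrite /vol fineK// ge0_fin_numE ?measure_ge0// mu_cell_lty.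
Qed.

Lemma vol_le j k x : (j <= k)%N -> vol k x <= vol j x.
Proof.
move=> jk; rewrite -lee_fin -!volE le_measure ?inE//.
exact: subset_cell.
Qed.

Lemma measurable_saturated k D : saturated k D -> measurable D.
Proof.
move=> sD; rewrite [D](_ : _ = \bigcup_(m in iota k @` D) (iota k @^-1` [set m])).
  by apply: bigcup_measurable => m _; exact: measurable_iota.
apply/seteqP; split=> [x Dx|x [_ [y Dy <-]] /= e].
  by exists (iota k x) => //; exists x.
by apply: (sD y) => //.
Qed.

Lemma measurable_cell_constant k d' (T' : measurableType d') (u : T -> T') D :
  measurable D -> cell_constant k u -> measurable_fun D u.
Proof.
move=> mD uk _ B mB; apply: measurableI => //.
by apply: (@measurable_saturated k) => x y /= Bx /uk <-.
Qed.

(** A saturated set is a countable disjoint union of cells, so integral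
    inequalities can be checked cell by cell. All sums over cells below are
    hidden in uses of this lemma. *)
Lemma le_integral_cells k (D : set T) (u v : T -> \bar R) :
  saturated k D -> measurable_fun [set: T] u -> measurable_fun [set: T] v ->
  (forall x, 0 <= u x)%E -> (forall x, 0 <= v x)%E ->
  (forall x, D x -> \int[mu]_(y in cell k x) u y <= \int[mu]_(y in cell k x) v y)%E ->
  (\int[mu]_(y in D) u y <= \int[mu]_(y in D) v y)%E.
Proof.
move=> sD mu_ mv u0 v0 uv.
have mD := measurable_saturated sD.
pose F m := D `&` iota k @^-1` [set m].
have mF m : measurable (F m) by apply: measurableI => //; exact: measurable_iota.
have DE : D = \bigcup_m F m.
  apply/seteqP; split=> [x Dx|x [m _ []]//].
  by exists (iota k x).
have tF : trivIset [set: nat] F.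
  by apply/trivIsetP => i j _ _ ij; apply/seteqP; split=> // x [[_ /= xi] [_ /= xj]];
    move: ij; rewrite -xi -xj eqxx.
rewrite DE !ge0_integral_bigcup//; last 2 first.
- by apply: measurable_funS mv.
- by apply: measurable_funS mu_.
apply: lee_nneseries => i _; first by move=> *; exact: integral_ge0.
have [[x Fx]|F0] := pselect (exists x, F i x).
  have -> : F i = cell k x.
    case: Fx => Dx /= ix; apply/seteqP; split=> [y [Dy /= iy]|y].
      by rewrite /cell/= iy.
    rewrite /cell/= => yx; split; last by rewrite /= yx.
    by apply: (sD x).
  by apply: uv; case: Fx.
have -> : F i = set0.
  by apply/seteqP; split=> // y Fy; apply: F0; exists y.
by rewrite !integral_set0.
Qed.

Lemma eq_integral_cells k (D : set T) (u v : T -> \bar R) :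
  saturated k D -> measurable_fun [set: T] u -> measurable_fun [set: T] v ->
  (forall x, 0 <= u x)%E -> (forall x, 0 <= v x)%E ->
  (forall x, D x -> \int[mu]_(y in cell k x) u y = \int[mu]_(y in cell k x) v y)%E ->
  (\int[mu]_(y in D) u y = \int[mu]_(y in D) v y)%E.
Proof.
move=> sD mu_ mv u0 v0 uv; apply/eqP; rewrite eq_le.
by apply/andP; split; apply: (@le_integral_cells k) => // x /uv ->.
Qed.

Lemma integral_cell_constant k x (u : T -> R) : cell_constant k u ->
  (\int[mu]_(y in cell k x) (u y)%:E = (u x * vol k x)%:E)%E.
Proof.
move=> uk; rewrite (_ : (\int[mu]_(y in cell k x) (u y)%:E =
  \int[mu]_(y in cell k x) (cst (u x)%:E) y)%E).
  by rewrite integral_cst// volE EFinM.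
apply: eq_integral => y; rewrite inE => yx; congr (_%:E); exact: uk.
Qed.

Lemma integral_cell_lty k f x : cell_integrable f ->
  (\int[mu]_(y in cell k x) (f y)%:E < +oo)%E.
Proof.
move=> [mf f0 fi]; apply: le_lt_trans (fi x).
apply: ge0_subset_integral => //.
- by apply: measurable_funS (measurableT_comp _ mf).
- by move=> y _; rewrite lee_fin.
- exact: subset_cell.
Qed.

Lemma integral_cellE k f x : cell_integrable f ->
  (\int[mu]_(y in cell k x) (f y)%:E = (mean k f x * vol k x)%:E)%E.
Proof.
move=> fi; rewrite /mean -lock divfK ?gt_eqF ?vol_gt0// fineK//.
rewrite ge0_fin_numE ?integral_cell_lty//.
by case: fi => _ f0 _; apply: integral_ge0 => y _; rewrite lee_fin.
Qed.

Lemma mean_ge0 k f x : (forall x, 0 <= f x) -> 0 <= mean k f x.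
Proof.
move=> f0; rewrite /mean -lock; apply: divr_ge0; last exact/ltW/vol_gt0.
by apply: fine_ge0; apply: integral_ge0 => y _; rewrite lee_fin.
Qed.

Lemma mean_vol_le j k f x : (j <= k)%N -> cell_integrable f ->
  mean k f x * vol k x <= mean j f x * vol j x.
Proof.
move=> jk fi; rewrite -lee_fin -!integral_cellE//; have [mf f0 _] := fi.
apply: ge0_subset_integral => //.
- by apply: measurable_funTS; exact: measurableT_comp.
- by move=> y _; rewrite lee_fin.
- exact: subset_cell.
Qed.

Lemma le_mean k f g x : cell_integrable f -> cell_integrable g ->
  (forall x, f x <= g x) -> mean k f x <= mean k g x.
Proof.
move=> fi gi fg; rewrite -(ler_pM2r (vol_gt0 k x)) -lee_fin -!integral_cellE//.
have [mf f0 _] := fi; have [mg g0 _] := gi.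
apply: ge0_le_integral => //.
- by move=> y _; rewrite lee_fin.
- by apply: measurable_funTS; exact: measurableT_comp.
- by apply: measurable_funTS; exact: measurableT_comp.
- by move=> y _; rewrite lee_fin.
Qed.

(** [mean k] is the conditional expectation with respect to the [k]-th
    partition, and this is its defining property, for [u] measurable at level
    [k]. *)
Lemma integral_mean k (u f : T -> R) D : cell_constant k u -> (forall x, 0 <= u x) ->
  cell_integrable f -> saturated k D ->
  (\int[mu]_(y in D) (u y * mean k f y)%:E = \int[mu]_(y in D) (u y * f y)%:E)%E.
Proof.
move=> uk u0 fi sD; have [mf f0 _] := fi.
have muT : measurable_fun [set: T] u by exact: measurable_cell_constant uk.
have mm : measurable_fun [set: T] (mean k f).
  by apply: (@measurable_cell_constant k) => //; exact: mean_constant.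
apply: (@eq_integral_cells k) => //.
- by apply: measurableT_comp => //; exact: measurable_funM.
- by apply: measurableT_comp => //; exact: measurable_funM.
- by move=> x; rewrite lee_fin mulr_ge0 ?mean_ge0.
- by move=> x; rewrite lee_fin mulr_ge0.
move=> x Dx; transitivity ((u x)%:E * \int[mu]_(y in cell k x) (f y)%:E)%E.
  rewrite (@integral_cell_constant k x (fun y => u y * mean k f y)); last first.
    by move=> y z e; rewrite (uk _ _ e) (mean_constant _ e).
  by rewrite integral_cellE// -EFinM -mulrA.
rewrite -ge0_integralZl_EFin//.
- by apply: eq_integral => y; rewrite inE => yx; rewrite EFinM (uk _ _ yx).
- by move=> y _; rewrite lee_fin.
- by apply: measurable_funS (measurableT_comp _ mf).
Qed.

End nested_partitions.

(** * Selected cells and their sparseness *)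

Section stopping_cells.
Context d (T : measurableType d) (R : realType).
Variables (mu : {measure set T -> \bar R}) (iota : nat -> T -> nat).
Hypothesis H : nested_partition mu iota.
Variables (m : nat) (f : 'I_m -> T -> R).
Hypothesis fi : forall i, cell_integrable mu iota (f i).

Hint Extern 0 (measurable (cell _ _ _)) => exact: (measurable_cell H) : core.
Local Notation cell := (cell iota).
Local Notation mean := (mean mu iota).
Local Notation vol := (vol mu iota).

Let f0 i x : 0 <= f i x. Proof. by have [_ + _] := fi i; exact. Qed.

(** The level of the smallest selected cell among those of level at most [k]
    around [x]: the selected cells of level [k] consist of the points with [stop
    k x = k]. The factor [2m] makes each of the [m] functions responsible for a
    proportion [1/(2m)] of a cell. *)
Fixpoint stop k (x : T) : nat :=
  if k is j.+1 then
    if [exists i, m.*2%:R * mean (stop j x) (f i) x < mean j.+1 (f i) x]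
    then j.+1 else stop j x
  else 0.

Lemma stop_le k x : (stop k x <= k)%N.
Proof. by elim: k => //= k IH; case: ifP => // _; exact: leqW. Qed.

Lemma stop_constant k : cell_constant iota k (stop k).
Proof.
elim: k => [//|k IH] x y e /=.
have e' := iota_nested H e.
have -> : stop k x = stop k y by exact: IH.
rewrite (_ : [exists i, _] = [exists i, m.*2%:R * mean (stop k y) (f i) y < mean k.+1 (f i) y])//.
apply: eq_existsb => i; rewrite (mean_constant _ _ e).
by rewrite (mean_constant mu (f i) (iota_mono H (stop_le k y) e')).
Qed.

(** If level [k] is not selected, the means of all functions have grown by a
    factor at most [2m] since the last selected level. *)
Lemma mean_stop k x i : mean k (f i) x <= m.*2%:R * mean (stop k x) (f i) x.
Proof.
have le1 (a : R) : 0 <= a -> a <= m.*2%:R * a.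
  move=> a0; rewrite ler_peMl// ler1n.
  by move: i; case: m => // -[].
elim: k => [|k IH] /=; first by rewrite le1// mean_ge0.
case: ifP => [_|]; first by rewrite le1// mean_ge0.
by move=> /negbT/existsPn/(_ i); rewrite -leNgt.
Qed.

Lemma stop_idem k x : stop (stop k x) x = stop k x.
Proof. by elim: k => //= k IH; case: ifP => // e /=; rewrite e. Qed.

(** Let [g] be the sum of the [f i / (2m * mean j (f i) x)]; its integral over
    the cell is at most half of the volume. A cell where the stopping level
    leaves [j] has been selected because of some [i], so the mean of [g] over it
    is at least 1. Hence the set where the stopping level has left [j] has
    measure at most the integral of [g]. *)
Lemma stop_sparse j k x : (j <= k)%N -> stop j x = j ->
  ((vol j x)%:E <= 2%:E * mu (cell j x `&` [set y | stop k y = j]))%E.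
Proof.
move=> jk sj.
pose M i := (m.*2%:R * mean j (f i) x)^-1.
pose g y := \sum_(i < m) M i * f i y.
have M0 i : 0 <= M i by rewrite invr_ge0 mulr_ge0// mean_ge0.
have g0 y : 0 <= g y by apply: sumr_ge0 => i _; rewrite mulr_ge0.
have mf i : measurable_fun [set: T] (f i) by have [] := fi i.
have mg : measurable_fun [set: T] g.
  by apply: measurable_sum => i; apply: measurable_funM.
have int_g l y : (\int[mu]_(z in cell l y) (g z)%:E =
    (vol l y * \sum_(i < m) M i * mean l (f i) y)%:E)%E.
  under eq_integral do rewrite -sumEFin.
  rewrite ge0_integral_sum//; last 2 first.
  - move=> i; apply: measurable_funTS; apply: measurableT_comp => //.
    exact: measurable_funM.
  - by move=> i z _; rewrite lee_fin mulr_ge0.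
  rewrite mulr_sumr -sumEFin; apply: eq_bigr => i _.
  under eq_integral do rewrite EFinM.
  rewrite ge0_integralZl_EFin//; last 2 first.
  - by move=> z _; rewrite lee_fin.
  - by apply: measurable_funTS; apply: measurableT_comp.
  by rewrite (integral_cellE H)// -EFinM mulrA mulrC.
pose B l := cell j x `&` [set y | stop l y != j].
have sB l : (j <= l)%N -> saturated iota l (B l).
  move=> jl y z [yx /= sy] e; split; first exact: (saturated_cell H jl yx e).
  by rewrite /= -(stop_constant e).
have mB l : (j <= l)%N -> measurable (B l).
  by move=> jl; apply: (measurable_saturated H (sB l jl)).
(* Induction on the last level: [D] collects the points whose stopping level
   leaves [j] exactly at level [l.+1]. *)
have muB l : (j <= l)%N -> (mu (B l) <= \int[mu]_(y in B l) (g y)%:E)%E.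
  move/subnK <-; elim: (l - j)%N => [|i].
    rewrite add0n (_ : B j = set0) ?measure0 ?integral_set0//.
    apply/seteqP; split=> // y [yx] /=.
    by rewrite (stop_constant yx) sj eqxx.
  rewrite addSn; have := leq_addl i j; move: (i + j)%N => {i}l {}jl IH.
  pose D := B l.+1 `\` B l.
  have BE : B l.+1 = B l `|` D.
    rewrite /D setDUK// => y [yx /= sy]; split => //=.
    case: ifP => // _; apply/eqP => e.
    by move: jl; rewrite -e ltnn.
  have sD : saturated iota l.+1 D.
    move=> y z [By Bly] e; split; first exact: (sB _ (leqW jl) _ _ By e).
    by move=> Blz; apply/Bly/(sB _ jl _ _ Blz)/esym/(iota_nested H).
  have mD : measurable D by exact: (measurable_saturated H sD).
  have BD : [disjoint B l & D] by apply/disj_setPS; rewrite /D setDIK.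
  rewrite BE measureU//; try exact: mB; last by rewrite /D setDIK.
  rewrite ge0_integral_setU//; last 3 first.
  - exact: mB.
  - by apply: measurable_funTS; apply: measurableT_comp.
  - by move=> y _; rewrite lee_fin.
  apply: leeD => //.
  rewrite -[leLHS]mul1e -integral_cst//.
  apply: (le_integral_cells H sD) => //; first exact: measurableT_comp.
  move=> y [[yx /= + ] sy].
  have {}sy : stop l y = j.
    by apply: contrapT => /eqP sy'; apply: sy.
  rewrite sy; case: ifP; last by rewrite eqxx.
  move=> /existsP[i hi] _; rewrite int_g integral_cst//.
  rewrite mul1e (volE H) lee_fin ler_peMr ?(vol_ge0 H)//.
  rewrite (bigD1 i)//= -[leLHS]addr0 lerD//; last first.
    by apply: sumr_ge0 => i' _; rewrite mulr_ge0// mean_ge0.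
  move: hi; rewrite (mean_constant mu (f i) yx) => hi.
  (* If the mean over the large cell vanishes, so does the mean over the small
     one, and nothing is selected because of [i]. *)
  have Mi : 0 < m.*2%:R * mean j (f i) x.
    rewrite lt_neqAle eq_sym mulr_ge0 ?mean_ge0// andbT.
    apply/eqP => h0; move: hi; rewrite h0.
    have m0 : m.*2%:R != 0 :> R by move: (i); case: (m) => // -[].
    move/eqP: h0; rewrite mulf_eq0 (negbTE m0)/= => /eqP h0.
    have := mean_vol_le H y (leqW jl) (fi i).
    rewrite (mean_constant mu (f i) yx) h0 mul0r => h1 h2.
    by move: h1; rewrite leNgt mulr_gt0// (vol_gt0 H).
  by rewrite /M mulrC ler_pdivlMr// mul1r ltW.
have mE : measurable (cell j x `&` [set y | stop k y = j]).
  apply: (@measurable_saturated _ _ _ _ _ H k) => y z [yx /= sy] e.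
  split; first exact: (saturated_cell H jk yx e).
  by rewrite /= -(stop_constant e).
have := muB _ jk; set E := mu (_ `&` [set y | stop k y = j]) => h.
have hB : (mu (B k) <= (2^-1 * vol j x)%:E)%E.
  apply: (le_trans h).
  apply: (@le_trans _ _ (\int[mu]_(y in cell j x) (g y)%:E)%E).
    apply: ge0_subset_integral => //; first exact: mB.
    - by apply: measurable_funTS; exact: measurableT_comp.
    - by move=> y _; rewrite lee_fin.
    - exact: subIsetl.
  rewrite int_g lee_fin mulrC ler_wpM2r ?(vol_ge0 H)//.
  apply: (@le_trans _ _ (\sum_(i < m) (m.*2%:R)^-1)).
    apply: ler_sum => i _; rewrite /M invfM -mulrA ler_piMr ?invr_ge0//.
    have [->|n0] := eqVneq (mean j (f i) x) 0; first by rewrite mulr0.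
    by rewrite mulVf.
  rewrite sumr_const card_ord -mul2n natrM invfM -mulrnAr -[_ *+ m]mulr_natr.
  case: m => [|m'].
    by rewrite !mulr0 invr_ge0.
  by rewrite mulVf ?mulr1// pnatr_eq0.
have : (mu (cell j x) <= E + mu (B k))%E.
  rewrite (_ : cell j x = (cell j x `&` [set y | stop k y = j]) `|` B k).
    by apply: measureU2 => //; exact: mB.
  rewrite /B -setIUr (_ : _ `|` _ = setT) ?setIT//.
  by apply/seteqP; split=> // y _ /=; case: eqVneq => ?; [left|right].
rewrite (volE H) => hv.
have E0 : (0 <= E)%E by exact: measure_ge0.
have := le_trans hv (leeD2l E hB).
case: E E0 {h hv} => [e| |]//=.
  by rewrite !lee_fin => e0 hv; lra.
by move=> _ _; rewrite mulry gtr0_sg// mul1e leey.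
Qed.

End stopping_cells.

(** * Packing of the selected cells *)

(** The integral of a nonnegative function is the supremum of the integrals of
    the simple functions below it, so it is monotone without any measurability.
    This is why the measurability of the maximal functions is never an issue. *)
Lemma ge0_le_lower_integral d (T : measurableType d) (R : realType)
    (mu : {measure set T -> \bar R}) (D : set T) (u v : T -> \bar R) :
  (forall x, D x -> 0 <= u x)%E -> (forall x, D x -> u x <= v x)%E ->
  (\int[mu]_(x in D) u x <= \int[mu]_(x in D) v x)%E.
Proof.
move=> u0 uv; have v0 x : D x -> (0 <= v x)%E.
  by move=> Dx; exact: le_trans (u0 _ Dx) (uv _ Dx).
rewrite !ge0_integralE//; apply: ereal_sup_le => _ /= [h hu <-].
exists h => // x; apply: (le_trans (hu x)).
by rewrite /patch; case: ifPn => //; rewrite inE => Dx; exact: uv.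
Qed.

Section packing.
Context d (T : measurableType d) (R : realType).
Variables (mu : {measure set T -> \bar R}) (iota : nat -> T -> nat).
Hypothesis H : nested_partition mu iota.
Variables (m : nat) (f : 'I_m -> T -> R).
Hypothesis fi : forall i, cell_integrable mu iota (f i).

Hint Extern 0 (measurable (cell _ _ _)) => exact: (measurable_cell H) : core.
Local Notation cell := (cell iota).
Local Notation mean := (mean mu iota).
Local Notation vol := (vol mu iota).
Local Notation stop := (stop mu iota f).

(** On a selected cell of level [j] the set where the final stopping level is
    [j] fills at least half of the cell, and these sets are disjoint for
    different [j]. The integral of [s] over the selected cells is thus at most
    twice the integral of [mean (stop N y) s y], which [G] dominates; in the
    application [G] is the maximal function of [s]. *)
Lemma stop_packing k N x (s : T -> R) (G : T -> \bar R) :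
  cell_integrable mu iota s ->
  (forall j y, cell k x y -> (k <= j)%N -> (mean j s y)%:E <= G y)%E ->
  (\int[mu]_(y in cell k x) (s y * \sum_(k <= j < N.+1) (stop j y == j)%:R)%:E <=
   2%:E * \int[mu]_(y in cell k x) G y)%E.
Proof.
move=> si sG; have [ms s0 _] := si.
have mind l j : measurable_fun [set: T] (fun y => (stop l y == j)%:R : R).
  apply: (@measurable_cell_constant _ _ _ _ _ H l) => // y z e.
  by rewrite (stop_constant H f e).
have mmean j : measurable_fun [set: T] (mean j s).
  by apply: (@measurable_cell_constant _ _ _ _ _ H j) => //; exact: mean_constant.
have G0 y : cell k x y -> (0 <= G y)%E.
  by move=> /sG/(_ (leqnn k)); apply: le_trans; rewrite lee_fin mean_ge0.
have step j : (k <= j <= N)%N ->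
  (\int[mu]_(y in cell k x) (s y * (stop j y == j)%:R)%:E <=
   2%:E * \int[mu]_(y in cell k x) ((stop N y == j)%:R * mean j s y)%:E)%E.
  move=> /andP[kj jN].
  under eq_integral do rewrite mulrC.
  rewrite -(integral_mean H _ _ si (saturated_cell H kj)); last 2 first.
  - by move=> y z e; rewrite (stop_constant H f e).
  - by [].
  rewrite -ge0_integralZl_EFin//; last 2 first.
  - by move=> y _; rewrite lee_fin mulr_ge0// mean_ge0.
  - by apply: measurable_funTS; apply: measurableT_comp => //; exact: measurable_funM.
  apply: (le_integral_cells H (saturated_cell H kj)).
  - by apply: measurableT_comp => //; exact: measurable_funM.
  - apply: measurable_funeM; apply: measurableT_comp => //; exact: measurable_funM.
  - by move=> y; rewrite lee_fin mulr_ge0// mean_ge0.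
  - by move=> y; rewrite -EFinM lee_fin mulr_ge0// mulr_ge0// mean_ge0.
  move=> y yx; rewrite (@integral_cell_constant _ _ _ _ _ H j y
      (fun y => (stop j y == j)%:R * mean j s y)); last first.
    by move=> z w e; rewrite (stop_constant H f e) (mean_constant mu s e).
  case: (eqVneq (stop j y) j) => [sj|_]; last first.
    rewrite !mul0r; apply: integral_ge0 => z _.
    by rewrite -EFinM lee_fin mulr_ge0// mulr_ge0// mean_ge0.
  rewrite (_ : (\int[mu]_(_ in _) _)%E = \int[mu]_(z in cell j y)
      ((2 * mean j s y)%:E * (\1_[set z | stop N z = j] z)%:E)%E)%E; last first.
    apply: eq_integral => z; rewrite inE => zy.
    rewrite (mean_constant mu s zy) -!EFinM; congr (_%:E).
    rewrite mulrCA [RHS]mulrC indicE; congr (_%:R * _).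
    by case: eqVneq => [e|/eqP ne]; [rewrite mem_set|rewrite memNset].
  have mE : measurable [set z | stop N z = j].
    apply: (@measurable_saturated _ _ _ _ _ H N) => z w /= <- e.
    by rewrite (stop_constant H f e).
  rewrite ge0_integralZl_EFin//; last 2 first.
  - by apply: measurable_funTS; apply: measurableT_comp.
  - by rewrite mulr_ge0// mean_ge0.
  rewrite integral_indic// mul1r setIC.
  rewrite EFinM (mulrC 2) EFinM -muleA; apply: lee_wpmul2l.
    by rewrite lee_fin mean_ge0.
  exact: stop_sparse.
under eq_integral do rewrite mulr_sumr -sumEFin.
rewrite ge0_integral_sum//; last 2 first.
- move=> j; apply: measurable_funTS; apply: measurableT_comp => //.
  exact: measurable_funM.
- by move=> j y _; rewrite lee_fin mulr_ge0.
apply: (@le_trans _ _ (\sum_(k <= j < N.+1)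
    (2%:E * \int[mu]_(y in cell k x) ((stop N y == j)%:R * mean j s y)%:E))%E).
  rewrite big_nat_cond [leRHS]big_nat_cond; apply: lee_sum => j.
  by rewrite andbT ltnS; exact: step.
rewrite -ge0_sume_distrr; last first.
  by move=> j _; apply: integral_ge0 => y _; rewrite lee_fin mulr_ge0// mean_ge0.
apply: lee_wpmul2l => //.
rewrite -ge0_integral_sum//; last 2 first.
- move=> j; apply: measurable_funTS; apply: measurableT_comp => //.
  exact: measurable_funM.
- by move=> j y _; rewrite lee_fin mulr_ge0// mean_ge0.
apply: ge0_le_lower_integral => y yx.
  by apply: sume_ge0 => j _; rewrite lee_fin mulr_ge0// mean_ge0.
rewrite sumEFin (eq_bigr (fun j => if j == stop N y then mean j s y else 0)); last first.
  by move=> j _; rewrite eq_sym; case: eqP; rewrite ?mul1r ?mul0r.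
rewrite -big_mkcond big_nat1_eq; case: ifP => [/andP[kN _]|_]; first exact: sG.
exact: G0.
Qed.

End packing.

(** * The Carleson embedding theorem *)

(** The graph of [t ^ p] lies above its tangent at [r]; after multiplication by
    [y] with [t = x / y] it says that [(x / y) ^ p * y], which is jointly convex
    in [x] and [y], lies above its tangent planes. *)
Lemma powR_tangent (R : realType) (p t r : R) : 1 < p -> 0 <= t -> 0 <= r ->
  p * r `^ (p - 1) * t <= t `^ p + (p - 1) * r `^ p.
Proof.
move=> p1 t0 r0; have p0 : 0 < p by lra.
have q0 : 0 < p / (p - 1) by rewrite divr_gt0//; lra.
have pq : p^-1 + (p / (p - 1))^-1 = 1 by field; rewrite !gt_eqF//; lra.
have := conjugate_powR t0 (powR_ge0 r (p - 1)) p0 q0 pq.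
rewrite -powRrM (_ : (p - 1) * (p / (p - 1)) = p); last by field; rewrite gt_eqF//; lra.
move=> h; have := ler_wpM2l (ltW p0) h.
rewrite (_ : p * (t * r `^ (p - 1)) = p * r `^ (p - 1) * t); last by ring.
rewrite (_ : p * (t `^ p / p + _) = t `^ p + (p - 1) * r `^ p)//.
by field; rewrite !gt_eqF//; lra.
Qed.

Section carleson.
Context d (T : measurableType d) (R : realType).
Variables (mu : {measure set T -> \bar R}) (iota : nat -> T -> nat).
Hypothesis H : nested_partition mu iota.

Hint Extern 0 (measurable (cell _ _ _)) => exact: (measurable_cell H) : core.
Local Notation cell := (cell iota).
Local Notation mean := (mean mu iota).
Local Notation vol := (vol mu iota).

Variables (N : nat) (A p : R) (s : nat -> T -> bool) (f g : T -> R).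
Hypotheses (A1 : 1 <= A) (p1 : 1 < p).
Hypothesis sc : forall k, cell_constant iota k (s k).
Hypothesis fi : cell_integrable mu iota f.
Hypothesis gi : cell_integrable mu iota g.
Hypothesis g_gt0 : forall k x, 0 < mean k g x.
Hypothesis pack : forall k x, (k <= N)%N ->
  (\int[mu]_(y in cell k x) (g y * \sum_(k <= j < N) (s j y)%:R)%:E <=
   A%:E * \int[mu]_(y in cell k x) (g y)%:E)%E.

Let A0 : 0 < A. Proof. exact: lt_le_trans A1. Qed.

(** The Bellman function [Phi k = (f / Hm k) ^ p * Hm k], in terms of means, is
    convex in the pair of the mean of [f] and of [Hm k]. The variable [Hm k],
    the mean of [h k], adds to the mean of [g] the normalised mass of the
    selected cells from level [k] on, so that it stays between the mean of [g]
    and its double, and it drops by [A^-1 * mean k g x] when level [k] is passed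
    at a selected cell. *)
Let h k y := g y + A^-1 * (g y * \sum_(k <= j < N) (s j y)%:R).

Let ms j D : measurable D -> measurable_fun D (fun y => (s j y)%:R : R).
Proof.
move=> mD; apply: (measurable_cell_constant H (k := j)) => // y z e.
by rewrite (sc e).
Qed.

Let hi k : cell_integrable mu iota (h k).
Proof.
have [mg g0 goo] := gi; split.
- apply: measurable_funD => //; apply: measurable_funM => //.
  by apply: measurable_funM => //; apply: measurable_sum => j; exact: ms.
- move=> y; rewrite addr_ge0// mulr_ge0// ?invr_ge0 ?(ltW A0)// mulr_ge0//.
  exact: sumr_ge0.
move=> x; apply: (@le_lt_trans _ _ (\int[mu]_(y in cell 0 x) ((1 + N%:R)%:E * (g y)%:E))%E).
  apply: ge0_le_integral => //.
  - move=> y _; rewrite lee_fin addr_ge0// mulr_ge0// ?invr_ge0 ?(ltW A0)// mulr_ge0//.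
    exact: sumr_ge0.
  - apply: measurable_funTS; apply: measurableT_comp => //.
    apply: measurable_funD => //; apply: measurable_funM => //.
    by apply: measurable_funM => //; apply: measurable_sum => j; exact: ms.
  - by apply: measurable_funTS; apply: measurable_funeM; exact: measurableT_comp.
  move=> y _; rewrite -EFinM lee_fin mulrDl mul1r lerD2l mulrCA [leRHS]mulrC.
  apply: ler_wpM2l => //; rewrite -[leRHS]mul1r; apply: ler_pM => //.
  - by rewrite invr_ge0 ltW.
  - exact: sumr_ge0.
  - by rewrite invf_le1.
  apply: (@le_trans _ _ (\sum_(k <= j < N) 1)).
    by apply: ler_sum => j _; case: (s j y).
  by rewrite big_const_nat iter_addr_0 ler_nat leq_subr.
rewrite ge0_integralZl_EFin//.
- by rewrite lte_mul_pinfty.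
- by move=> y _; rewrite lee_fin.
- by apply: measurable_funTS; exact: measurableT_comp.
Qed.

Let Hm k := mean k (h k).

Let le_mean_Hm k x : mean k g x <= Hm k x.
Proof.
apply: (le_mean H) => // y; rewrite lerDl mulr_ge0// ?invr_ge0 ?(ltW A0)// mulr_ge0//.
  by case: gi.
exact: sumr_ge0.
Qed.

Let Hm_gt0 k x : 0 < Hm k x.
Proof. exact: lt_le_trans (g_gt0 k x) (le_mean_Hm k x). Qed.

Let Hm_le k x : (k <= N)%N -> Hm k x <= 2 * mean k g x.
Proof.
move=> kN; have [mg g0 goo] := gi.
rewrite -(ler_pM2r (vol_gt0 H k x)) -lee_fin -integral_cellE//.
under eq_integral do rewrite EFinD.
have mS : measurable_fun [set: T] (fun y => g y * \sum_(k <= j < N) (s j y)%:R).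
  by apply: measurable_funM => //; apply: measurable_sum => j; exact: ms.
have S0 y : 0 <= g y * \sum_(k <= j < N) (s j y)%:R by rewrite mulr_ge0// sumr_ge0.
rewrite ge0_integralD//; last 4 first.
- by move=> y _; rewrite lee_fin.
- by apply: measurable_funTS; exact: measurableT_comp.
- by move=> y _; rewrite lee_fin mulr_ge0// invr_ge0 ltW.
- apply: measurable_funTS; apply: measurableT_comp => //.
  exact: measurable_funM.
under [in X in (_ + X)%E]eq_integral do rewrite EFinM.
rewrite ge0_integralZl_EFin//; last 3 first.
- by move=> y _; rewrite lee_fin.
- by apply: measurable_funTS; exact: measurableT_comp.
- by rewrite invr_ge0 ltW.
apply: (@le_trans _ _ (mean k g x * vol k x +
   A^-1 * (A * (mean k g x * vol k x)))%:E).
  rewrite EFinD -integral_cellE//; apply: leeD => //.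
  rewrite EFinM; apply: lee_wpmul2l; first by rewrite lee_fin invr_ge0 ltW.
  by rewrite (le_trans (pack _ kN))// EFinM (integral_cellE H).
by rewrite mulKf ?gt_eqF// lee_fin; lra.
Qed.

Let mean_h k x : (k < N)%N ->
  mean k (h k.+1) x = Hm k x - A^-1 * ((s k x)%:R * mean k g x).
Proof.
move=> kN; have [mg g0 goo] := gi; apply/eqP; rewrite eq_sym subr_eq; apply/eqP.
have [mh h0 _] := hi k.+1.
apply: (mulIf (lt0r_neq0 (vol_gt0 H k x))); apply/EFin_inj.
rewrite -(integral_cellE H)//.
rewrite (_ : (\int[mu]_(y in cell k x) _)%E = (\int[mu]_(y in cell k x)
    ((h k.+1 y)%:E + (A^-1 * (s k x)%:R)%:E * (g y)%:E)%E)%E); last first.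
  apply: eq_integral => y; rewrite inE => yx.
  rewrite -EFinM -EFinD; congr (_%:E).
  by rewrite /h big_ltn// (sc yx); ring.
rewrite ge0_integralD//; last 4 first.
- by move=> y _; rewrite lee_fin.
- by apply: measurable_funTS; exact: measurableT_comp.
- by move=> y _; rewrite -EFinM lee_fin !mulr_ge0// invr_ge0 ltW.
- apply: measurable_funTS; apply: measurable_funeM; exact: measurableT_comp.
rewrite ge0_integralZl_EFin//; last 3 first.
- by move=> y _; rewrite lee_fin.
- by apply: measurable_funTS; exact: measurableT_comp.
- by rewrite mulr_ge0// invr_ge0 ltW.
by rewrite !(integral_cellE H)// -EFinM -EFinD; congr (_%:E); ring.
Qed.

Let Phi k x := (mean k f x / Hm k x) `^ p * Hm k x.

Let Phi_constant k : cell_constant iota k (Phi k).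
Proof.
by move=> x y e; rewrite /Phi /Hm (mean_constant mu f e) (mean_constant mu (h k) e).
Qed.

Local Notation c := ((p - 1) * 2^-1 `^ p * A^-1).

Let E k x := (s k x)%:R * (mean k f x / mean k g x) `^ p * mean k g x.

Let E_constant k : cell_constant iota k (E k).
Proof.
by move=> x y e; rewrite /E (sc e) (mean_constant mu f e) (mean_constant mu g e).
Qed.

Let Phi_ge0 k x : 0 <= Phi k x.
Proof. by rewrite mulr_ge0 ?powR_ge0 ?ltW. Qed.

Let E_ge0 k x : 0 <= E k x.
Proof. by rewrite mulr_ge0 ?mulr_ge0 ?powR_ge0// ltW. Qed.

Let c_ge0 : 0 <= c.
Proof.
apply: mulr_ge0; last by rewrite invr_ge0 ltW.
by apply: mulr_ge0; [rewrite subr_ge0 ltW|exact: powR_ge0].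
Qed.

(** Integrating over the cell the tangent inequality at [r = mean k f x / Hm k
    x] gives convexity of [Phi]; the decrease of [Hm] at selected cells leaves
    the term of the Carleson sum as a gain. *)
Let Phi_step k x : (k < N)%N ->
  (((Phi k x + c * E k x) * vol k x)%:E <= \int[mu]_(y in cell k x) (Phi k.+1 y)%:E)%E.
Proof.
move=> kN; have [mf f0 foo] := fi; have p_gt1 := p1.
pose F := mean k f x; pose S := mean k g x; pose G := Hm k x.
pose r := F / G; pose V := vol k x.
have F0 : 0 <= F by exact: mean_ge0.
have r0 : 0 <= r by rewrite divr_ge0// ltW// Hm_gt0.
have mc (u : T -> R) l : cell_constant iota l u -> measurable_fun (cell k x) u.
  by move=> ul; apply: (measurable_cell_constant H) ul.
have int1 : (\int[mu]_(y in cell k x) ((p * r `^ (p - 1) * mean k.+1 f y)%:E) =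
    ((p * r `^ (p - 1)) * (F * V))%:E)%E.
  rewrite (integral_mean H (k := k.+1))//; last first.
    exact: (saturated_cell H (leqnSn k)).
    by rewrite !mulr_ge0// ?powR_ge0//; lra.
  under eq_integral do rewrite EFinM.
  rewrite ge0_integralZl_EFin//; last 3 first.
  - by move=> y _; rewrite lee_fin.
  - by apply: measurable_funTS; exact: measurableT_comp.
  - by rewrite mulr_ge0// ?powR_ge0//; lra.
  by rewrite (integral_cellE H).
have int2 : (\int[mu]_(y in cell k x) (((p - 1) * r `^ p * Hm k.+1 y)%:E) =
    (((p - 1) * r `^ p) * ((G - A^-1 * ((s k x)%:R * S)) * V))%:E)%E.
  have [mh h0 _] := hi k.+1.
  rewrite (integral_mean H (k := k.+1))//; last first.
    exact: (saturated_cell H (leqnSn k)).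
    by rewrite !mulr_ge0// ?powR_ge0//; lra.
  under eq_integral do rewrite EFinM.
  rewrite ge0_integralZl_EFin//; last 3 first.
  - by move=> y _; rewrite lee_fin.
  - by apply: measurable_funTS; exact: measurableT_comp.
  - by rewrite mulr_ge0// ?powR_ge0//; lra.
  by rewrite (integral_cellE H)// mean_h.
have : (\int[mu]_(y in cell k x) ((p * r `^ (p - 1) * mean k.+1 f y)%:E) <=
   \int[mu]_(y in cell k x) ((Phi k.+1 y)%:E + ((p - 1) * r `^ p * Hm k.+1 y)%:E)%E)%E.
  apply: ge0_le_integral => //.
  - move=> y _; rewrite lee_fin mulr_ge0 ?mean_ge0// mulr_ge0 ?powR_ge0//; lra.
  - apply: measurableT_comp => //; apply: measurable_funM => //.
    exact: mc (mean_constant mu f (k := k.+1)).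
  - apply: emeasurable_funD; apply: measurableT_comp => //.
      exact: mc (@Phi_constant k.+1).
    apply: measurable_funM => //.
    exact: mc (mean_constant mu (h k.+1) (k := k.+1)).
  move=> y _; rewrite -EFinD lee_fin /Phi.
  have G0 := Hm_gt0 k.+1 y.
  have t0 : 0 <= mean k.+1 f y / Hm k.+1 y by apply: divr_ge0; [exact: mean_ge0|exact: ltW].
  have := ler_wpM2r (ltW G0) (powR_tangent p1 t0 r0).
  by rewrite mulrDl -[X in X <= _ -> _]mulrA divfK// gt_eqF.
rewrite int1 ge0_integralD//; last 4 first.
- by move=> y _; rewrite lee_fin.
- by apply: measurableT_comp => //; exact: mc (@Phi_constant k.+1).
- move=> y _; rewrite lee_fin; apply: mulr_ge0; last exact/ltW/Hm_gt0.
  by rewrite mulr_ge0 ?powR_ge0//; lra.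
- apply: measurableT_comp => //; apply: measurable_funM => //.
  exact: mc (mean_constant mu (h k.+1) (k := k.+1)).
rewrite int2 -leeBlDr// -EFinB; apply: le_trans.
rewrite lee_fin -/V.
have FrG : F = r * G by rewrite /r divfK// gt_eqF ?Hm_gt0.
have rp : r * r `^ (p - 1) = r `^ p by rewrite mulr_powRB1//; lra.
have -> : p * r `^ (p - 1) * (F * V) = p * r `^ p * G * V.
  by rewrite FrG -rp; ring.
rewrite /Phi -/F -/G -/r -/S.
rewrite [leRHS](_ : _ = (r `^ p * G + (p - 1) * r `^ p * (A^-1 * ((s k x)%:R * S))) * V);
  last by ring.
apply: ler_wpM2r; first exact: (vol_ge0 H).
rewrite lerD2l /E -/F -/S.
have S0 : 0 < S by exact: g_gt0.
rewrite [leLHS](_ : _ = (p - 1) * (2^-1 `^ p * (F / S) `^ p) * (A^-1 * ((s k x)%:R * S)));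
  last by ring.
apply: ler_wpM2r; first by rewrite mulr_ge0 ?invr_ge0 ?(ltW A0)// mulr_ge0// ltW.
apply: ler_wpM2l; first by rewrite subr_ge0 ltW.
rewrite -powRM ?invr_ge0//; last by rewrite divr_ge0// ltW.
apply: ge0_ler_powR; rewrite ?nnegrE ?mulr_ge0 ?invr_ge0 ?(ltW S0)//; first lra.
  exact/ltW/Hm_gt0.
rewrite mulrCA -invfM; apply: ler_wpM2l => //.
by rewrite lef_pV2 ?posrE ?mulr_gt0//; [exact: Hm_le (ltnW kN)|exact: Hm_gt0].
Qed.

(** Telescoping [Phi_step] bounds the Carleson sum by the integral of [Phi N],
    where the sum defining [h N] is empty, so that [h N = g] and the hypothesis
    on [W] applies. *)
Lemma carleson_embedding (W : T -> \bar R) :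
  measurable_fun [set: T] W -> (forall x, 0 <= W x)%E ->
  (forall x, ((mean N f x / mean N g x) `^ p * mean N g x * vol N x)%:E <=
     \int[mu]_(y in cell N x) W y)%E ->
  (((p - 1) * 2^-1 `^ p * A^-1)%:E * \sum_(k < N)
    \int[mu]_x ((s k x)%:R * (mean k f x / mean k g x) `^ p * mean k g x)%:E <=
  \int[mu]_x W x)%E.
Proof.
move=> mW W0 hW.
have mPhi k : measurable_fun [set: T] (Phi k).
  exact: (measurable_cell_constant H _ (@Phi_constant k)).
have mE k : measurable_fun [set: T] (E k).
  exact: (measurable_cell_constant H _ (@E_constant k)).
have sT k : saturated iota k setT by [].
have telescope n : (n <= N)%N ->
  (c%:E * \sum_(k < n) \int[mu]_x (E k x)%:E <= \int[mu]_x (Phi n x)%:E)%E.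
  elim: n => [_|n IH nN].
    by rewrite big_ord0 mule0; apply: integral_ge0 => y _; rewrite lee_fin.
  rewrite big_ord_recr/= ge0_muleDr//; last 2 first.
  - by apply: sume_ge0 => k _; apply: integral_ge0 => y _; rewrite lee_fin.
  - by apply: integral_ge0 => y _; rewrite lee_fin.
  apply: (le_trans (leeD2r _ (IH (ltnW nN)))).
  rewrite -ge0_integralZl_EFin//; last 2 first.
  - by move=> y _; rewrite lee_fin.
  - exact: measurableT_comp.
  rewrite -ge0_integralD//; last 4 first.
  - by move=> y _; rewrite lee_fin.
  - exact: measurableT_comp.
  - by move=> y _; rewrite -EFinM lee_fin mulr_ge0.
  - by apply: measurable_funeM; exact: measurableT_comp.
  apply: (le_integral_cells H (sT n)).
  - apply: emeasurable_funD; first exact: measurableT_comp.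
    by apply: measurable_funeM; exact: measurableT_comp.
  - exact: measurableT_comp.
  - by move=> y; rewrite -EFinM -EFinD lee_fin addr_ge0// mulr_ge0.
  - by move=> y; rewrite lee_fin.
  move=> x _; apply: le_trans (Phi_step x nN).
  by rewrite -(@integral_cell_constant _ _ _ _ _ H n x (fun y => Phi n y + c * E n y))// => y z e;
    rewrite (Phi_constant e) (E_constant e).
apply: (le_trans (telescope N (leqnn N))).
apply: (le_integral_cells H (sT N)) => //.
- exact: measurableT_comp.
- by move=> y; rewrite lee_fin.
move=> x _; rewrite (integral_cell_constant H x (@Phi_constant N)).
rewrite /Phi /Hm (_ : h N = g)//.
by apply/funext => y; rewrite /h big_geq// !mulr0 addr0.
Qed.

End carleson.

(** * The inequality on a single cell *)

Lemma gt0_powRD (R : realType) (x r s : R) : 0 < x ->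
  x `^ (r + s) = x `^ r * x `^ s.
Proof. by move=> x0; rewrite powRD// (gt_eqF x0); apply/implyP. Qed.

Lemma gt0_powR_sum (R : realType) (I : finType) (a : I -> R) (x : R) : 0 < x ->
  x `^ (\sum_i a i) = \prod_i x `^ a i.
Proof.
move=> x0; rewrite (big_morph (fun t => x `^ t) (id1 := 1) (op1 := *%R))//.
  by move=> s t; exact: gt0_powRD.
exact: powRr0.
Qed.

Lemma powR_prod (R : realType) (I : finType) (G : I -> R) r :
  (forall i, 0 <= G i) -> (\prod_i G i) `^ r = \prod_i G i `^ r.
Proof.
move=> G0; suff [] : 0 <= \prod_i G i /\ (\prod_i G i) `^ r = \prod_i G i `^ r by [].
apply: (big_ind2 (fun u v => 0 <= u /\ u `^ r = v)) => [|u v u' v' [u0 <-] [u0' <-]|i _].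
- by rewrite powR1.
- by split; [exact: mulr_ge0|rewrite powRM].
- by split.
Qed.

(** With [S] the weighted mean, [y i / S <= expR (y i / S - 1)]; in the product
    of the [a i]-th powers the exponents add up to 0. *)
Lemma weighted_AMGM (R : realType) (m : nat) (a y : 'I_m -> R) :
  (forall i, 0 < a i) -> \sum_(i < m) a i = 1 -> (forall i, 0 <= y i) ->
  \prod_(i < m) y i `^ a i <= \sum_(i < m) a i * y i.
Proof.
move=> a0 a1 y0; set S := \sum_(i < m) a i * y i.
have S0 : 0 <= S by apply: sumr_ge0 => i _; rewrite mulr_ge0// ltW.
have prodE (F : 'I_m -> R) : \prod_(i < m) expR (F i) = expR (\sum_(i < m) F i).
  by rewrite expR_sum.
have [SE|Sn0] := eqVneq S 0.
  have [i0 _|no] := pickP (fun _ : 'I_m => true); last first.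
    by move: a1; rewrite big_pred0// => /esym/eqP; rewrite oner_eq0.
  have : a i0 * y i0 = 0.
    apply/eqP; rewrite eq_le mulr_ge0 ?(ltW (a0 _))// andbT -SE.
    rewrite /S (bigD1 i0)//= lerDl; apply: sumr_ge0 => i _.
    by rewrite mulr_ge0// ltW.
  move/eqP; rewrite mulf_eq0 gt_eqF//= => /eqP y00.
  by rewrite SE (bigD1 i0)//= y00 powR0 ?mul0r// gt_eqF.
have Sp : 0 < S by rewrite lt_neqAle eq_sym Sn0.
have -> : \prod_(i < m) y i `^ a i = S * \prod_(i < m) (y i / S) `^ a i.
  rewrite -[X in X * _](powRr1 S0) -[X in _ `^ X * _]a1.
  rewrite gt0_powR_sum//.
  rewrite -big_split/=; apply: eq_bigr => i _.
  by rewrite -powRM// ?divr_ge0// mulrC divfK.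
rewrite -[leRHS]mulr1; apply: ler_wpM2l => //.
apply: (@le_trans _ _ (\prod_(i < m) expR (a i * (y i / S - 1)))).
  apply: ler_prod => i _; rewrite powR_ge0/=.
  rewrite [a i * _]mulrC expRM.
  apply: ge0_ler_powR; rewrite ?nnegrE ?expR_ge0 ?divr_ge0 ?(ltW (a0 _))//.
  have := expR_ge1Dx (y i / S - 1); rewrite addrC subrK //.
rewrite prodE (eq_bigr (fun i => a i * y i / S - a i)); last first.
  by move=> i _; rewrite mulrBr mulr1 mulrA.
rewrite sumrB a1 -mulr_suml -/S divff// subrr expR0//.
Qed.

(** Numbers in [0, 1] only decrease when raised to a power larger than 1. This
    is where [q >= p] enters. *)
Lemma prod_powR_le_wmean (R : realType) (m : nat) (a y : 'I_m -> R) (t : R) :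
  (forall i, 0 < a i) -> \sum_(i < m) a i = 1 -> (forall i, 0 <= y i <= 1) ->
  1 <= t ->
  \prod_(i < m) y i `^ (a i * t) <= \sum_(i < m) a i * y i.
Proof.
move=> a0 a1 y01 t1; apply: le_trans (weighted_AMGM a0 a1 (fun i => proj1 (andP (y01 i)))).
apply: ler_prod => i _; rewrite powR_ge0/=; have /andP[y0 y1] := y01 i.
have [->|yn0] := eqVneq (y i) 0.
  by rewrite !powR0 ?mulf_neq0 ?gt_eqF//; exact: lt_le_trans t1.
apply: ger_powR; first by rewrite lt_neqAle eq_sym yn0 y0.
by rewrite ler_peMr// ltW.
Qed.

(** On a cell of volume [V], with [F], [S] and [U] the means of |f_i|, sigma_i
    and nu^q, and [K] the A_(P,q) constant, the exponents leave only [V^-1] of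
    all powers of [V]. The product of the [x i ^ (q / P i)], with [x i] the i-th
    term of the Carleson sum, is linearised around the upper bounds [B i] so
    that the sum over the cells can be taken factor by factor. *)
Lemma testing_le_sum (R : realType) (m : nat) (P F S B : 'I_m -> R)
    (p q beta V U K : R) :
  (forall i, 1 < P i) -> p^-1 = \sum_(i < m) (P i)^-1 -> q^-1 = p^-1 - beta ->
  0 < p -> p <= q ->
  (forall i, 0 <= F i) -> (forall i, 0 < S i) -> (forall i, 0 < B i) ->
  0 < V -> 0 <= U ->
  U * \prod_(i < m) S i `^ (q - q / P i) <= K ->
  (forall i, (F i / S i) `^ P i * S i * V <= B i) ->
  (V `^ beta * \prod_(i < m) F i) `^ q * U <=
  K * \prod_(i < m) B i `^ (q / P i) *
    \sum_(i < m) (p / P i / B i) * ((F i / S i) `^ P i * S i).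
Proof.
move=> P1 pE qE p0 pq F0 S0 B0 V0 U0 hK xB.
have q0 : 0 < q by exact: lt_le_trans pq.
have P0 i : 0 < P i by exact: lt_trans (P1 i).
pose x i := (F i / S i) `^ P i * S i * V.
have x0 i : 0 <= x i by rewrite !mulr_ge0 ?powR_ge0// ltW.
have -> : (V `^ beta * \prod_(i < m) F i) `^ q * U =
    (U * \prod_(i < m) S i `^ (q - q / P i)) * V^-1 * \prod_(i < m) x i `^ (q / P i).
  rewrite powRM ?powR_ge0 ?prodr_ge0// powR_prod// -powRrM.
  have -> : beta * q = q / p - 1.
    have -> : beta = p^-1 - q^-1 by rewrite qE opprB addrCA subrr addr0.
    by field; rewrite !gt_eqF.
  rewrite gt0_powRD// powRN powRr1 ?(ltW V0)//.
  have -> : V `^ (q / p) = \prod_(i < m) V `^ (q / P i).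
    by rewrite pE mulr_sumr gt0_powR_sum.
  rewrite (mulrC _ U) -!mulrA; congr (U * _).
  rewrite [RHS]mulrCA [LHS]mulrCA; congr (_ * _).
  rewrite -!big_split/=; apply: eq_bigr => i _.
  have FS : F i = F i / S i * S i by rewrite divfK// gt_eqF.
  rewrite /x powRM ?mulr_ge0 ?powR_ge0 ?(ltW (S0 i)) ?(ltW V0)//.
  rewrite powRM ?powR_ge0 ?(ltW (S0 i))// -powRrM.
  have -> : P i * (q / P i) = q by field; rewrite gt_eqF.
  rewrite {1}FS powRM ?divr_ge0 ?(ltW (S0 i))//.
  have -> : S i `^ q = S i `^ (q - q / P i) * S i `^ (q / P i).
    by rewrite -gt0_powRD// subrK.
  ring.
apply: (@le_trans _ _ (K * V^-1 * \prod_(i < m) x i `^ (q / P i))).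
  apply: ler_wpM2r; first by apply: prodr_ge0 => i _; exact: powR_ge0.
  by apply: ler_wpM2r => //; rewrite invr_ge0 ltW.
have K0 : 0 <= K.
  apply: le_trans hK; apply: mulr_ge0 => //.
  by apply: prodr_ge0 => i _; exact: powR_ge0.
rewrite -!mulrA; apply: ler_wpM2l => //.
have -> : \prod_(i < m) x i `^ (q / P i) =
    \prod_(i < m) B i `^ (q / P i) * \prod_(i < m) (x i / B i) `^ (p / P i * (q / p)).
  rewrite -big_split/=; apply: eq_bigr => i _.
  rewrite (_ : p / P i * (q / p) = q / P i); last by field; rewrite !gt_eqF.
  rewrite -powRM ?divr_ge0 ?(ltW (B0 i))//; congr (_ `^ _).
  by rewrite mulrC divfK// gt_eqF.
rewrite mulrCA; apply: ler_wpM2l.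
  by apply: prodr_ge0 => i _; exact: powR_ge0.
rewrite ler_pdivrMl//.
apply: le_trans (prod_powR_le_wmean (a := fun i => p / P i) _ _ _ _) _.
- by move=> i; rewrite divr_gt0.
- by rewrite -mulr_sumr -pE divff// gt_eqF.
- by move=> i; rewrite divr_ge0 ?(ltW (B0 i))//= ler_pdivrMr// mul1r xB.
- by rewrite ler_pdivlMr// mul1r.
rewrite mulr_sumr; apply: ler_sum => i _; rewrite le_eqVlt; apply/orP; left.
by apply/eqP; rewrite /x; ring.
Qed.

(** * Summation over the selected cells of one partition *)

Section dyadic_bound.
Context d (T : measurableType d) (R : realType).
Variables (mu : {measure set T -> \bar R}) (iota : nat -> T -> nat).
Hypothesis H : nested_partition mu iota.

Hint Extern 0 (measurable (cell _ _ _)) => exact: (measurable_cell H) : core.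
Local Notation cell := (cell iota).
Local Notation mean := (mean mu iota).
Local Notation vol := (vol mu iota).

Variables (m : nat) (P : 'I_m -> R) (f g : 'I_m -> T -> R) (u : T -> R).
Variables (W : 'I_m -> T -> \bar R) (a I : 'I_m -> R) (p q beta K : R).

Local Notation stop := (stop mu iota f).
Local Notation E i k x := ((stop k x == k)%:R *
  (mean k (f i) x / mean k (g i) x) `^ P i * mean k (g i) x).

Hypotheses (P1 : forall i, 1 < P i) (pE : p^-1 = \sum_(i < m) (P i)^-1).
Hypotheses (qE : q^-1 = p^-1 - beta) (p0 : 0 < p) (pq : p <= q).
Hypothesis fi : forall i, cell_integrable mu iota (f i).
Hypothesis gi : forall i, cell_integrable mu iota (g i).
Hypothesis ui : cell_integrable mu iota u.
Hypothesis g_gt0 : forall i k x, 0 < mean k (g i) x.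
Hypothesis K0 : 0 <= K.
Hypothesis testing : forall k x,
  mean k u x * \prod_(i < m) mean k (g i) x `^ (q - q / P i) <= K.
Hypothesis mW : forall i, measurable_fun [set: T] (W i).
Hypothesis W0 : forall i x, (0 <= W i x)%E.
Hypothesis IW : forall i, (\int[mu]_x W i x = (I i)%:E)%E.
Hypothesis I0 : forall i, 0 < I i.
Hypothesis a1 : forall i, 1 <= a i.
Hypothesis fgW : forall i k x,
  (((mean k (f i) x / mean k (g i) x) `^ P i * mean k (g i) x * vol k x)%:E <=
   \int[mu]_(y in cell k x) W i y)%E.
Hypothesis Ainfty : forall i k x, exists2 G : T -> \bar R,
  (forall j y, cell k x y -> (k <= j)%N -> (mean j (g i) y)%:E <= G y)%E &
  (\int[mu]_(y in cell k x) G y <= (a i)%:E * \int[mu]_(y in cell k x) (g i y)%:E)%E.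

Let c i := (P i - 1) * 2^-1 `^ P i * (2 * a i)^-1.

Let c_gt0 i : 0 < c i.
Proof.
have := P1 i; have := a1 i => ai Pi; apply: mulr_gt0.
  by apply: mulr_gt0; [lra|rewrite powR_gt0 ?invr_gt0].
by rewrite invr_gt0; lra.
Qed.

Let E_ge0 i k x : 0 <= E i k x.
Proof. by rewrite mulr_ge0 ?(ltW (g_gt0 _ _ _))// mulr_ge0// powR_ge0. Qed.

Let E_constant i k : cell_constant iota k (fun x => E i k x).
Proof.
move=> x y e; rewrite (stop_constant H f e).
by rewrite (mean_constant mu (f i) e) (mean_constant mu (g i) e).
Qed.

Let mE i k : measurable_fun [set: T] (fun x => E i k x).
Proof. exact: (measurable_cell_constant H _ (@E_constant i k)). Qed.

(** The packing constant is twice the [a i] of the A_infinity condition: a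
    factor 2 is lost in the sparseness of the selected cells. *)
Lemma sparse_embedding i N :
  (\sum_(k < N.+1) \int[mu]_x (E i k x)%:E <= (I i / c i)%:E)%E.
Proof.
have A1 : 1 <= 2 * a i by have := a1 i; lra.
have pack k x : (k <= N.+1)%N ->
  (\int[mu]_(y in cell k x) (g i y * \sum_(k <= j < N.+1) (stop j y == j)%:R)%:E <=
   (2 * a i)%:E * \int[mu]_(y in cell k x) (g i y)%:E)%E.
  move=> _; have [G gG Ga] := Ainfty i k x.
  apply: (le_trans (stop_packing H fi N (gi i) gG)).
  by rewrite EFinM -muleA; apply: lee_wpmul2l.
have sc k : cell_constant iota k (fun x => stop k x == k).
  by move=> x y e; rewrite (stop_constant H f e).
have := carleson_embedding H A1 (P1 i) sc (fi i) (gi i) (g_gt0 i) pack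
  (mW i) (W0 i) (fgW i N.+1).
by rewrite IW -/(c i) => h; rewrite [leRHS]EFinM lee_pdivlMr// muleC.
Qed.

Let E_le i N k x : (k <= N)%N -> stop k x = k ->
  (mean k (f i) x / mean k (g i) x) `^ P i * mean k (g i) x * vol k x <= I i / c i.
Proof.
move=> kN sk; rewrite -lee_fin; apply: le_trans (sparse_embedding i N).
have k1 : (k < N.+1)%N by [].
rewrite (bigD1 (Ordinal k1))//=.
apply: (@le_trans _ _ (\int[mu]_x (E i k x)%:E)%E); last first.
  rewrite -[leLHS]adde0; apply: leeD => //.
  by apply: sume_ge0 => j _; apply: integral_ge0 => y _; rewrite lee_fin.
apply: (@le_trans _ _ (\int[mu]_(y in cell k x) (E i k y)%:E)%E).
  rewrite (@integral_cell_constant _ _ _ _ _ H k x (fun x => E i k x))//.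
    by rewrite sk eqxx mul1r.
apply: ge0_subset_integral => //; first exact: measurableT_comp.
by move=> y _; rewrite lee_fin.
Qed.

(** On each selected cell the product is replaced by a sum over [i] with weights
    [p / P i / (I i / c i)]; by the Carleson embedding the [i]-th sum over the
    cells is at most [I i / c i], and the [p / P i] add up to 1. *)
Lemma dyadic_bound N :
  (\sum_(k < N.+1) \int[mu]_x ((stop k x == k)%:R *
     ((vol k x `^ beta * \prod_(i < m) mean k (f i) x) `^ q) * u x)%:E <=
   (K * \prod_(i < m) (I i / c i) `^ (q / P i))%:E)%E.
Proof.
have B0 i : 0 < I i / c i by rewrite divr_gt0.
have P0 i : 0 < P i by exact: lt_trans (P1 i).
have u0 x : 0 <= u x by case: ui.
have f0 i x : 0 <= f i x by case: (fi i).
pose D := K * \prod_(i < m) (I i / c i) `^ (q / P i).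
have D0 : 0 <= D.
  by apply: mulr_ge0 => //; apply: prodr_ge0 => i _; exact: powR_ge0.
pose r i := p / P i / (I i / c i).
have r0 i : 0 <= r i by rewrite divr_ge0 ?ltW// divr_gt0.
pose v k x := (stop k x == k)%:R *
     ((vol k x `^ beta * \prod_(i < m) mean k (f i) x) `^ q).
have v0 k x : 0 <= v k x by rewrite mulr_ge0// powR_ge0.
have vk k : cell_constant iota k (v k).
  move=> x y e; rewrite /v (stop_constant H f e) (vol_constant mu e).
  by under eq_bigr do rewrite (mean_constant mu _ e).
(* On the cells of level [k], [u] may be replaced by its mean, and then the
   inequality is pointwise. *)
have step k : (k < N.+1)%N -> (\int[mu]_x (v k x * u x)%:E <=
    \sum_(i < m) (D * r i)%:E * \int[mu]_x (E i k x)%:E)%E.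
  move=> kN; rewrite -(integral_mean H (vk k) (v0 k) ui)//.
  under eq_bigr => i _.
    rewrite -ge0_integralZl_EFin//; last 3 first.
    - by move=> x _; rewrite lee_fin.
    - exact: measurableT_comp.
    - by rewrite mulr_ge0.
    over.
  rewrite /= -ge0_integral_sum//; last 2 first.
  - by move=> i; apply: measurable_funeM; exact: measurableT_comp.
  - by move=> i x _; rewrite -EFinM lee_fin mulr_ge0// mulr_ge0.
  apply: ge0_le_integral => //.
  - by move=> x _; rewrite lee_fin mulr_ge0// mean_ge0.
  - apply: measurableT_comp => //; apply: measurable_funM.
      exact: (measurable_cell_constant H _ (vk k)).
    exact: (measurable_cell_constant H _ (mean_constant mu u (k := k))).
  - by apply: emeasurable_sum => i; apply: measurable_funeM; exact: measurableT_comp.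
  move=> x _; under eq_bigr do rewrite -EFinM.
  rewrite sumEFin lee_fin /v.
  case: (eqVneq (stop k x) k) => [sk|_]; last first.
    by rewrite !mul0r; apply: sumr_ge0 => i _; rewrite !mul0r mulr0.
  rewrite [leRHS](eq_bigr (fun i => D * (r i *
      ((mean k (f i) x / mean k (g i) x) `^ P i * mean k (g i) x)))); last first.
    by move=> i _; rewrite [true%:R * _]mul1r -mulrA.
  rewrite mul1r.
  rewrite -mulr_sumr.
  apply: (testing_le_sum P1 pE qE p0 pq _ _ B0 _ _ (testing k x) _) => //.
  - by move=> i; exact: mean_ge0.
  - exact: (vol_gt0 H).
  - exact: mean_ge0.
  - by move=> i; apply: (@E_le i N).
apply: (@le_trans _ _ (\sum_(k < N.+1) \sum_(i < m) (D * r i)%:E * \int[mu]_x (E i k x)%:E)%E).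
  by apply: lee_sum => k _; exact: step.
rewrite exchange_big/=.
apply: (@le_trans _ _ (\sum_(i < m) (D * r i * (I i / c i))%:E)%E).
  apply: lee_sum => i _; rewrite -ge0_sume_distrr; last first.
    by move=> k _; apply: integral_ge0 => x _; rewrite lee_fin.
  rewrite [leRHS]EFinM; apply: lee_wpmul2l; first by rewrite lee_fin mulr_ge0.
  exact: sparse_embedding.
rewrite sumEFin lee_fin (eq_bigr (fun i => D * (p / P i))); last first.
  by move=> i _; rewrite -mulrA divfK// gt_eqF.
by rewrite -!mulr_sumr -pE divff ?mulr1// gt_eqF.
Qed.

End dyadic_bound.

(** * Boxes, cubes and translated dyadic grids *)

Section boxes.
Context (R : realType) (n : nat).
Local Notation X := (euclid R n).

Lemma measurable_ecoord_box (B : 'I_n -> set (measurableTypeR R)) :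
  (forall i, measurable (B i)) ->
  measurable [set x : X | forall i, B i (ecoord x i)].
Proof.
move=> mB; apply: sub_caratheodory; apply: sub_sigma_algebra.
rewrite [X in measurable X](_ : _ = \bigcap_(i in [set: 'I_n])
    (@tnth n (measurableTypeR R) ^~ i @^-1` B i)); last first.
  by apply/seteqP; split=> x /= Bx => [i _|i]; exact: Bx.
apply: fin_bigcap_measurable => [|i _]; first exact: finite_finset.
by rewrite -[X in measurable X]setTI; exact: measurable_tnth.
Qed.

Definition box (a : 'I_n -> R) (l : R) : set X :=
  [set x | forall i, a i <= ecoord x i < a i + l].

Definition cube (a : 'I_n -> R) (l : R) : set X :=
  [set x | forall i, a i <= ecoord x i <= a i + l].

Lemma boxE a l : box a l =
  [set x | forall i, `[a i, a i + l[%classic (ecoord x i)].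
Proof. by apply/seteqP; split=> x /= h i; have := h i; rewrite in_itv. Qed.

Lemma cubeE a l : cube a l =
  [set x | forall i, `[a i, a i + l]%classic (ecoord x i)].
Proof. by apply/seteqP; split=> x /= h i; have := h i; rewrite in_itv. Qed.

Lemma measurable_box a l : measurable (box a l).
Proof. by rewrite boxE; apply: (@measurable_ecoord_box (fun i => `[a i, a i + l[%classic)). Qed.

Lemma measurable_cube a l : measurable (cube a l).
Proof. by rewrite cubeE; apply: (@measurable_ecoord_box (fun i => `[a i, a i + l]%classic)). Qed.

Lemma leb_box_cst a l : 0 < l -> leb (box a l) = (l ^+ n)%:E.
Proof.
move=> l0; rewrite boxE (leb_box (A := fun i => `[a i, a i + l[%classic))//.
rewrite (eq_bigr (fun=> l%:E)); last first.
  move=> i _; rewrite lebesgue_measure_itv/= lte_fin ltrDl l0.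
  by rewrite -EFinB addrAC subrr add0r.
by rewrite prodEFin prodr_const card_ord.
Qed.

Lemma leb_cube a l : 0 < l -> leb (cube a l) = (l ^+ n)%:E.
Proof.
move=> l0; rewrite cubeE (leb_box (A := fun i => `[a i, a i + l]%classic))//.
rewrite (eq_bigr (fun=> l%:E)); last first.
  move=> i _; rewrite lebesgue_measure_itv/= lte_fin ltrDl l0.
  by rewrite -EFinB addrAC subrr add0r.
by rewrite prodEFin prodr_const card_ord.
Qed.

Lemma box_sub_cube a l : box a l `<=` cube a l.
Proof. by move=> x h i; have /andP[-> /ltW] := h i. Qed.

Lemma cubesP Q : cubes Q <-> exists a l, 0 < l /\ Q = cube a l.
Proof.
split=> [[a [l l0 ->]]|[a [l [l0 ->]]]]; first by exists (ecoord a), l.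
exists [tuple a i | i < n]; exists l => //.
by apply/seteqP; split=> x /= h i; have := h i; rewrite /ecoord tnth_mktuple.
Qed.

Lemma cubes_cube a l : 0 < l -> cubes (cube a l).
Proof. by move=> l0; apply/cubesP; exists a, l. Qed.

(** The boundary of a cube is a null set because the cube and the half-open box
    have the same volume. *)
Lemma ge0_integral_box_cube a l (f : X -> \bar R) : 0 < l ->
  measurable_fun [set: X] f -> (forall x, 0 <= f x)%E ->
  (\int[@leb R n]_(x in box a l) f x = \int[@leb R n]_(x in cube a l) f x)%E.
Proof.
move=> l0 mf f0.
have mb := measurable_box a l; have mc := measurable_cube a l.
have bc := @box_sub_cube a l.
have N0 : leb (cube a l `\` box a l) = 0%E.
  have -> : leb (cube a l `\` box a l) =
      (leb (cube a l) - leb (cube a l `&` box a l))%E.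
    by apply: measureD => //; move: (ltry (l ^+ n)); rewrite -(leb_cube a l0).
  by rewrite setIidr// leb_cube// leb_box_cst// subee.
rewrite [RHS](ge0_negligible_integral _ _ _ _ N0)//; last 2 first.
- exact: measurableD.
- exact: measurable_funTS.
by rewrite setDD setIidr.
Qed.

End boxes.

Section dyadic_cells.
Context (R : realType) (n : nat).
Local Notation X := (euclid R n).
Variables (lam : R) (t : {ffun 'I_n -> bool}).

Definition grid_shift (i : 'I_n) : R := (t i)%:R * lam / 3.

(** All generations [k >= 0] are translated by the same vector, so the grid is
    nested for every choice of [t]. A third of [lam] is, modulo the side [lam /
    2 ^+ k] of the [k]-th generation, one third or two thirds of that side. *)
Definition dyadic_index k (x : X) : {ffun 'I_n -> int} :=
  [ffun i => Num.floor (2 ^+ k * (ecoord x i - grid_shift i) / lam)].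

Definition dyadic k (x : X) : nat := pickle (dyadic_index k x).

Definition dyadic_corner k (x : X) (i : 'I_n) : R :=
  grid_shift i + (lam / 2 ^+ k) * (dyadic_index k x i)%:~R.

Hypothesis lam0 : 0 < lam.

Lemma side_gt0 k : 0 < lam / 2 ^+ k.
Proof. by rewrite divr_gt0// exprn_gt0. Qed.

Lemma dyadicP k x y : dyadic k y = dyadic k x <->
  (forall i, dyadic_index k y i = dyadic_index k x i).
Proof.
split; first by move/(pcan_inj pickleK) => -> .
by move=> h; rewrite /dyadic; congr pickle; apply/ffunP.
Qed.

Lemma dyadic_index_eq k x (z : int) i :
  (dyadic_index k x i == z) =
  (grid_shift i + (lam / 2 ^+ k) * z%:~R <= ecoord x i <
   grid_shift i + (lam / 2 ^+ k) * z%:~R + lam / 2 ^+ k).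
Proof.
rewrite ffunE floor_eq; have w0 := side_gt0 k.
have E : 2 ^+ k * (ecoord x i - grid_shift i) / lam = (ecoord x i - grid_shift i) / (lam / 2 ^+ k).
  by field; rewrite !gt_eqF// exprn_gt0.
rewrite E ler_pdivlMr// ltr_pdivrMr// intrD mulrDl mul1r (mulrC z%:~R).
by rewrite lerBrDl ltrBlDl addrA.
Qed.

Lemma dyadic_cellE k x : cell dyadic k x = box (dyadic_corner k x) (lam / 2 ^+ k).
Proof.
apply/seteqP; split=> y.
  by move/dyadicP => h i; move/eqP: (h i); rewrite dyadic_index_eq.
by move=> h; apply/dyadicP => i; apply/eqP; rewrite dyadic_index_eq; exact: h.
Qed.

Lemma leb_dyadic_cell k x : leb (cell dyadic k x) = ((lam / 2 ^+ k) ^+ n)%:E.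
Proof. by rewrite dyadic_cellE leb_box_cst ?side_gt0. Qed.

(** The floor of [2 x] determines that of [x]: its half. *)
Lemma floor_double (x y : R) : Num.floor (2 * x) = Num.floor (2 * y) ->
  Num.floor x = Num.floor y.
Proof.
have key (z : R) : 2 * Num.floor z <= Num.floor (2 * z) < 2 * Num.floor z + 2.
  have /andP[h1 h2] := floor_itv z.
  rewrite floor_ge_int floor_lt_int !intrD !intrM.
  by move: h1 h2; rewrite intrD => h1 h2; apply/andP; split; lra.
by have := key x; have := key y => /[swap] + /[swap] e; rewrite e; lia.
Qed.

Lemma dyadic_partition : nested_partition (@leb R n) dyadic.
Proof.
split=> [k m|k x y|k x|k x].
- have [[x <-]|no] := pselect (exists x, dyadic k x = m).
    rewrite (_ : _ @^-1` _ = box (dyadic_corner k x) (lam / 2 ^+ k)).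
      exact: measurable_box.
    by rewrite -dyadic_cellE.
  rewrite (_ : _ @^-1` _ = set0)//; apply/seteqP; split=> // x /= xm.
  by apply: no; exists x.
- move/dyadicP => h; apply/dyadicP => i; have := h i; rewrite !ffunE.
  by rewrite !exprS -!mulrA; exact: floor_double.
- suff : (0 < leb (cell dyadic k x))%E by [].
  by rewrite leb_dyadic_cell lte_fin exprn_gt0// side_gt0.
- suff : (leb (cell dyadic k x) < +oo)%E by [].
  by rewrite leb_dyadic_cell ltry.
Qed.

Lemma dyadic_vol k x : vol (@leb R n) dyadic k x = (lam / 2 ^+ k) ^+ n.
Proof. by rewrite -[LHS]/(fine (leb (cell dyadic k x))) leb_dyadic_cell. Qed.

End dyadic_cells.

(** The reason for thirds: a power of 2 is not a multiple of 3, so no endpoint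
    of a translated grid is an endpoint of the original one, in any generation.
    *)
Lemma three_not_dvd_pow2 (k : nat) (j j' : int) : (3 * (j - j') - (2 ^ k)%N%:Z != 0).
Proof.
have h : (2 ^ k %% 3 != 0)%N.
  rewrite -/(dvdn 3 _) Euclid_dvdX//.
by lia.
Qed.

(** If the interval from [a] to [a + l] were cut by both grids, it would contain
    an endpoint of each, and two such endpoints are at distance at least a third
    of the side. *)
Lemma one_third (R : realType) (lam a l : R) (k : nat) : 0 < lam ->
  0 < l <= lam / 2 ^+ k / 3 ->
  exists b : bool,
    Num.floor (2 ^+ k * (a - b%:R * lam / 3) / lam) =
    Num.floor (2 ^+ k * (a + l - b%:R * lam / 3) / lam).
Proof.
move=> lam0 /andP[l0 ll].
have E0 := exprn_gt0 k (ltr0n R 2) .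
set w := lam / 2 ^+ k in ll.
have w0 : 0 < w by exact: side_gt0.
have lamE : lam = 2 ^+ k * w by rewrite /w mulrC divfK// gt_eqF.
pose s (b : bool) : R := b%:R * lam / 3.
pose j b := Num.floor ((a + l - s b) / w).
have wE y : 2 ^+ k * y / lam = y / w.
  by rewrite /w; field; rewrite !gt_eqF.
(* If both ends of the interval are in different cells, the left end of the cell
   of [a + l] lies in the interval. *)
have key b : Num.floor ((a - s b) / w) <> j b ->
    a < s b + w * (j b)%:~R <= a + l.
  move=> ne; have /andP[h1 _] := floor_itv ((a + l - s b) / w).
  apply/andP; split; last first.
    by move: h1; rewrite ler_pdivlMr// mulrC -/(j b); lra.
  rewrite ltNge; apply/negP => h; apply: ne; apply/eqP; rewrite eq_le.
  apply/andP; split.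
    by apply: le_floor; rewrite ler_pM2r ?invr_gt0//; lra.
  by rewrite floor_ge_int ler_pdivlMr// mulrC; lra.
have [e|/eqP/key n0] := eqVneq (Num.floor ((a - s false) / w)) (j false).
  by exists false; rewrite !wE.
have [e|/eqP/key n1] := eqVneq (Num.floor ((a - s true) / w)) (j true).
  by exists true; rewrite !wE.
exfalso; have := @three_not_dvd_pow2 k (j false) (j true).
apply/negP; rewrite negbK.
have : `|(3 * (j false - j true) - (2 ^ k)%N%:Z)%:~R : R| < 1.
  rewrite intrB intrM intrB -pmulrn natrX.
  move: n0 n1; rewrite /s !mul0r add0r mul1r lamE => /andP[h1 h2] /andP[h3 h4].
  rewrite -(ltr_pM2l w0) mulr1 -{1}(gtr0_norm w0) -normrM ltr_norml.
  by apply/andP; split; lra.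
by rewrite -intr_norm ltrz1; lia.
Qed.

Lemma cube_sub_dyadic_cell (R : realType) (n : nat) (lam l : R) (k : nat)
    (a : 'I_n -> R) : 0 < lam -> 0 < l <= lam / 2 ^+ k / 3 ->
  exists t, forall x : euclid R n, cube a l x ->
    cube a l `<=` cell (dyadic lam t) k x.
Proof.
move=> lam0 ll.
have /choice[b hb] := fun i => one_third (a i) lam0 ll.
have E0 := exprn_gt0 k (ltr0n R 2) .
exists [ffun i => b i] => x Qx y Qy; apply/dyadicP => i.
have sq (z : euclid R n) : cube a l z -> dyadic_index lam [ffun i => b i] k z i =
    Num.floor (2 ^+ k * (a i - (b i)%:R * lam / 3) / lam).
  move=> /(_ i)/andP[h1 h2]; rewrite ffunE /grid_shift ffunE.
  apply/eqP; rewrite eq_le; apply/andP; split; last first.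
    by apply: le_floor; rewrite ler_pM2r ?invr_gt0// ler_pM2l ?exprn_gt0//; lra.
  rewrite hb; apply: le_floor; rewrite ler_pM2r ?invr_gt0// ler_pM2l ?exprn_gt0//.
  lra.
by rewrite !sq.
Qed.

Lemma dyadic_scale (R : realType) (l : R) : 0 < l -> exists N0, forall N, (N0 <= N)%N ->
  exists2 k, (k <= N.*2)%N & l <= 2 ^+ N / 2 ^+ k < 2 * l.
Proof.
move=> l0; have E0 k := exprn_gt0 k (ltr0n R 2).
have natle (k : nat) : k%:R <= 2 ^+ k :> R.
  by rewrite -natrX ler_nat ltnW// ltn_expl.
(* [N0] makes the coarsest scale larger than [l] and the finest one smaller. *)
pose N0 := maxn (Num.bound l) (Num.bound l^-1); exists N0 => N N0N.
have lN : l <= 2 ^+ N.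
  apply: le_trans (natle N); apply: ltW; apply: (lt_le_trans (archi_boundP (ltW l0))).
  by rewrite ler_nat (leq_trans _ N0N)// leq_maxl.
have Nl : (2 ^+ N)^-1 <= l.
  rewrite -[leRHS]invrK lef_pV2 ?posrE ?invr_gt0//.
  apply: le_trans (natle N); apply: ltW.
  have := @archi_boundP R l^-1; rewrite invr_ge0 => /(_ (ltW l0)) h.
  by apply: (lt_le_trans h); rewrite ler_nat (leq_trans _ N0N)// leq_maxr.
have ex : exists k, 2 ^+ N / 2 ^+ k < 2 * l.
  exists N.*2; rewrite -addnn exprD invfM mulrA divff ?gt_eqF// mul1r.
  by apply: le_lt_trans Nl _; lra.
have [k hk kmin] := ex_minnP ex; exists k.
  apply: kmin; rewrite -addnn exprD invfM mulrA divff ?gt_eqF// mul1r.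
  by apply: le_lt_trans Nl _; lra.
apply/andP; split=> //; case: k hk kmin => [|k] hk kmin.
  by rewrite expr0 divr1.
rewrite leNgt; apply/negP => h.
suff : (k.+1 <= k)%N by rewrite ltnn.
apply: kmin; rewrite exprS invfM mulrCA in h.
by lra.
Qed.

(** * Integrals against a weight and its dual *)

Lemma integral_ae_gt0 d (T : measurableType d) (R : realType)
    (mu : {measure set T -> \bar R}) (D : set T) (f : T -> R) :
  measurable D -> (0 < mu D)%E -> measurable_fun [set: T] f ->
  (forall x, 0 <= f x) -> {ae mu, forall x, 0 < f x} ->
  (0 < \int[mu]_(x in D) (f x)%:E)%E.
Proof.
move=> mD D0 mf f0 fpos.
rewrite lt_neqAle eq_sym integral_ge0 ?andbT; last by move=> x _; rewrite lee_fin.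
apply/eqP => int0.
have mfD : measurable_fun D (EFin \o f) by apply: measurable_funTS; exact: measurableT_comp.
have : ae_eq mu D (EFin \o f) (cst 0%E).
  apply/ae_eq_integral_abs => //; rewrite -[RHS]int0; apply: eq_integral => x _.
  by rewrite /= ger0_norm.
move=> h; have : {ae mu, forall x, ~ D x}.
  apply: filterS2 h fpos => x /= h1 h2 Dx; have [h3] := h1 Dx.
  by rewrite h3 ltxx in h2.
move=> [N [mN N0 sN]]; move: D0; apply/negP; rewrite -leNgt -N0.
by apply: le_measure; rewrite ?inE// => x Dx; apply: sN => /= /(_ Dx).
Qed.

(** [powR_tangent] for [t = x / s] times [s], where [s = w ^ (- p')] satisfies
    [s ^ (1 - p) = w ^ p]. Integrated over a set, and for all [r], it replaces
    Hoelder's inequality. *)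
Lemma weight_tangent (R : realType) (p w x r : R) : 1 < p -> 0 < w -> 0 <= x -> 0 <= r ->
  p * r `^ (p - 1) * x <= x `^ p * w `^ p + (p - 1) * r `^ p * w `^ (- conj_exp p).
Proof.
move=> p1 w0 x0 r0; set s := w `^ (- conj_exp p).
have s0 : 0 < s by exact: powR_gt0.
have t0 : 0 <= x / s by rewrite divr_ge0// ltW.
have := ler_wpM2r (ltW s0) (powR_tangent p1 t0 r0).
rewrite mulrDl -[X in X <= _ -> _]mulrA divfK ?gt_eqF//.
suff -> : (x / s) `^ p * s = x `^ p * w `^ p by [].
rewrite powRM ?invr_ge0 ?(ltW s0)// -mulrA; congr (_ * _).
rewrite -powR_inv1 ?(ltW s0)// -powRrM -{2}(powRr1 (ltW s0)) -gt0_powRD//.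
rewrite /s -powRrM; congr (_ `^ _); rewrite /conj_exp; field.
by rewrite gt_eqF//; lra.
Qed.

Section weighted_integrals.
Context d (T : measurableType d) (R : realType).
Variables (mu : {measure set T -> \bar R}) (p : R) (w f : T -> R) (D : set T).
Hypotheses (p1 : 1 < p) (mD : measurable D).
Hypothesis w0 : forall x, 0 <= w x.
Hypothesis wpos : {ae mu, forall x, 0 < w x}.
Hypothesis mw : measurable_fun [set: T] w.
Hypothesis mf : measurable_fun [set: T] f.

Local Notation s := (fun x => w x `^ (- conj_exp p)).
Local Notation W := (fun x => `|f x| `^ p * w x `^ p).

Let mpow r D' : measurable_fun D' (fun x => w x `^ r).
Proof. by apply: measurable_funTS; exact: (measurableT_comp (measurable_powR r)). Qed.

Let mabs D' : measurable_fun D' (fun x => `|f x|).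
Proof. by apply: measurable_funTS; exact: measurableT_comp. Qed.

Let mWD D' : measurable_fun D' W.
Proof.
apply: measurable_funM => //.
exact: (measurableT_comp (measurable_powR p)).
Qed.

Lemma integral_weight_tangent r : 0 <= r ->
  ((p * r `^ (p - 1))%:E * \int[mu]_(x in D) (`|f x|)%:E <=
   \int[mu]_(x in D) (W x)%:E + ((p - 1) * r `^ p)%:E * \int[mu]_(x in D) (s x)%:E)%E.
Proof.
have pp := p1; move=> r0.
rewrite -!ge0_integralZl_EFin//; last 5 first.
- by move=> x _; rewrite lee_fin powR_ge0.
- by apply: measurableT_comp.
- by rewrite mulr_ge0 ?powR_ge0//; lra.
- by apply: measurableT_comp.
- by rewrite mulr_ge0 ?powR_ge0//; lra.
rewrite -ge0_integralD//; last 4 first.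
- by move=> x _; rewrite lee_fin mulr_ge0// powR_ge0.
- by apply: measurableT_comp.
- move=> x _; rewrite -EFinM lee_fin mulr_ge0 ?powR_ge0// mulr_ge0 ?powR_ge0//; lra.
- by apply: measurable_funeM; apply: measurableT_comp.
apply: ae_ge0_le_integral => //.
- move=> x _; rewrite -EFinM lee_fin mulr_ge0// mulr_ge0 ?powR_ge0//; lra.
- by apply: measurable_funeM; apply: measurableT_comp.
- move=> x _; rewrite -EFinM -EFinD lee_fin addr_ge0 ?mulr_ge0 ?powR_ge0//; lra.
- apply: emeasurable_funD; first exact: measurableT_comp.
  by apply: measurable_funeM; apply: measurableT_comp.
apply: filterS wpos => x wx _; rewrite -!EFinM -EFinD lee_fin.
exact: weight_tangent.
Qed.

Lemma integral_abs_lty : (\int[mu]_(x in D) (s x)%:E < +oo)%E ->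
  (\int[mu]_(x in D) (W x)%:E < +oo)%E -> (\int[mu]_(x in D) (`|f x|)%:E < +oo)%E.
Proof.
move=> soo Woo; have pp := p1.
have := integral_weight_tangent ler01.
rewrite !powR1 !mulr1 => /le_lt_trans h.
have {}h : (p%:E * \int[mu]_(x in D) (`|f x|)%:E < +oo)%E.
  apply: h; apply: lte_add_pinfty => //; apply: lte_mul_pinfty => //.
  by rewrite lee_fin; lra.
move: h; case: (\int[mu]_(x in D) (`|f x|)%:E)%E => //; first by move=> *; exact: ltry.
by rewrite gt0_muley// lte_fin; lra.
Qed.

(** Hoelder's inequality for |f| w and 1/w, in the form needed to start the
    Carleson embedding; the best tangent point is [r = F / S]. *)
Lemma holder_testing (F S V : R) : 0 <= F -> 0 < S -> 0 < V ->
  (\int[mu]_(x in D) (`|f x|)%:E = (F * V)%:E)%E ->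
  (\int[mu]_(x in D) (s x)%:E = (S * V)%:E)%E ->
  (((F / S) `^ p * S * V)%:E <= \int[mu]_(x in D) (W x)%:E)%E.
Proof.
move=> F0 S0 V0 fE sE; have pp := p1.
have r0 : 0 <= F / S by rewrite divr_ge0// ltW.
have := integral_weight_tangent r0; rewrite fE sE.
case: (\int[mu]_(x in D) (W x)%:E)%E => [y| |].
- rewrite -!EFinM -EFinD !lee_fin.
  have <- : F / S * (F / S) `^ (p - 1) = (F / S) `^ p by rewrite mulr_powRB1//; lra.
  have {2}-> : F = F / S * S by rewrite divfK// gt_eqF.
  by move: ((F / S) `^ (p - 1)) (F / S) => b a h; lra.
- by move=> _; rewrite leey.
- by rewrite addNye -EFinM leNgt ltNyr.
Qed.

End weighted_integrals.

(** * Limits inferior and products of extended reals *)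

Lemma limn_einf_supE (R : realType) (u : (\bar R)^nat) :
  limn_einf u = ereal_sup (range (einfs u)).
Proof.
by rewrite limn_einf_lim; apply/cvg_lim => //; apply: ereal_nondecreasing_cvgn;
  exact: nondecreasing_einfs.
Qed.

Lemma limn_einf_le (R : realType) (u : (\bar R)^nat) (b : \bar R) :
  (forall n, u n <= b)%E -> (limn_einf u <= b)%E.
Proof.
move=> ub; rewrite limn_einf_supE; apply: ge_ereal_sup => _ [n _ <-].
by apply: le_trans (ub n); apply: ereal_inf_lbound; exists n => /=.
Qed.

Lemma limn_einf_ge (R : realType) (u : (\bar R)^nat) (c : \bar R) (n : nat) :
  (forall k, (n <= k)%N -> c <= u k)%E -> (c <= limn_einf u)%E.
Proof.
move=> cu; rewrite limn_einf_supE.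
apply: (@le_trans _ _ (einfs u n)); last by apply: ereal_sup_ubound; exists n.
by apply: le_ereal_inf_tmp => _ [k /= nk <-]; exact: cu.
Qed.

Lemma gt0_mule_ltyl (R : realType) (x y : \bar R) :
  (0 < x)%E -> (0 < y)%E -> (x * y < +oo)%E -> (x < +oo)%E.
Proof.
move=> x0 y0; case: x x0 => // [r _ _|_]; first exact: ltry.
by rewrite gt0_mulye.
Qed.

Lemma prode_gt0 (R : realType) (I : finType) (F : I -> \bar R) :
  (forall i, 0 < F i)%E -> (0 < \prod_i F i)%E.
Proof. by move=> F0; elim/big_ind : _ => // *; exact: mule_gt0. Qed.

Lemma gt0_prode_lty (R : realType) (I : finType) (F : I -> \bar R) :
  (forall i, 0 < F i)%E -> (\prod_i F i < +oo)%E -> forall i, (F i < +oo)%E.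
Proof.
move=> F0 Foo i; move: Foo; rewrite (bigD1 i)//=; apply: gt0_mule_ltyl => //.
by elim/big_ind : _ => // *; exact: mule_gt0.
Qed.

Lemma gt0_prode_y (R : realType) (I : finType) (F : I -> \bar R) i :
  (forall i, 0 < F i)%E -> F i = +oo%E -> (\prod_i F i = +oo)%E.
Proof.
move=> F0 Fi; rewrite (bigD1 i)//= Fi gt0_mulye//.
by elim/big_ind : _ => // *; exact: mule_gt0.
Qed.

(** * Locally integrable functions on the dyadic grids and the A_infinity constant *)

Section locally_integrable.
Context (R : realType) (n : nat).
Local Notation X := (euclid R n).

Definition loc_integrable (f : X -> R) :=
  [/\ measurable_fun [set: X] f, forall x, 0 <= f x &
      forall a l, 0 < l -> (\int[@leb R n]_(x in cube a l) (f x)%:E < +oo)%E].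

Variables (lam : R) (t : {ffun 'I_n -> bool}).
Hypothesis lam0 : 0 < lam.

Local Notation mean := (mean (@leb R n) (dyadic lam t)).
Local Notation vol := (vol (@leb R n) (dyadic lam t)).

Definition dyadic_cube k (x : X) := cube (dyadic_corner lam t k x) (lam / 2 ^+ k).

Lemma dyadic_cube_cubes k x : cubes (dyadic_cube k x).
Proof. by apply: cubes_cube; exact: side_gt0. Qed.

Lemma cell_sub_dyadic_cube k x : cell (dyadic lam t) k x `<=` dyadic_cube k x.
Proof. by rewrite dyadic_cellE//; exact: box_sub_cube. Qed.

Lemma integral_dyadic_cell k x (f : X -> R) : measurable_fun [set: X] f ->
  (forall x, 0 <= f x) ->
  (\int[@leb R n]_(y in cell (dyadic lam t) k x) (f y)%:E =
   \int[@leb R n]_(y in dyadic_cube k x) (f y)%:E)%E.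
Proof.
move=> mf f0; rewrite dyadic_cellE//.
have mfE : measurable_fun [set: X] (EFin \o f) by apply/measurable_EFinP.
have f0E y : (0 <= (EFin \o f) y)%E by rewrite lee_fin.
exact: (ge0_integral_box_cube _ (side_gt0 lam0 k) mfE f0E).
Qed.

Lemma cell_integrable_loc f : loc_integrable f -> cell_integrable (@leb R n) (dyadic lam t) f.
Proof.
move=> [mf f0 fi]; split=> // x; rewrite integral_dyadic_cell//.
by apply: fi; exact: side_gt0.
Qed.

Lemma integral_dyadic_cube k x f : loc_integrable f ->
  (\int[@leb R n]_(y in dyadic_cube k x) (f y)%:E = (mean k f x * vol k x)%:E)%E.
Proof.
move=> fi; have [mf f0 _] := fi.
rewrite -integral_dyadic_cell// (integral_cellE (dyadic_partition t lam0))//.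
exact: cell_integrable_loc.
Qed.

Lemma leb_dyadic_cube k x : leb (dyadic_cube k x) = (vol k x)%:E.
Proof. by rewrite leb_cube ?side_gt0// dyadic_vol. Qed.

Lemma avg_dyadic_cube k x f : loc_integrable f ->
  avg (dyadic_cube k x) (fun y => (f y)%:E) = (mean k f x)%:E.
Proof.
move=> fi; rewrite /avg leb_dyadic_cube integral_dyadic_cube// inver.
have v0 := vol_gt0 (dyadic_partition t lam0) k x.
by rewrite gt_eqF// -EFinM mulrC mulfK// gt_eqF.
Qed.

Lemma mean_loc_gt0 k x f : loc_integrable f ->
  {ae @leb R n, forall x, 0 < f x} -> 0 < mean k f x.
Proof.
move=> fi fpos; have [mf f0 _] := fi.
have D := dyadic_partition t lam0.
have v0 := vol_gt0 D k x.
rewrite -(pmulr_lgt0 _ v0) -lte_fin -(integral_cellE D)//; last exact: cell_integrable_loc.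
apply: integral_ae_gt0 => //; first exact: (measurable_cell D).
exact: (mu_cell_gt0 D).
Qed.

(** The function [G] is the maximal function of [s] restricted to the closure of
    the cell. It dominates the means of [s] over all smaller cells, and the
    A_infinity condition bounds its integral; it is applied to the closed cube,
    which has the same [s]-mass as the cell. *)
Lemma Ainfty_dominate (s : X -> R) (a : R) : loc_integrable s ->
  {ae @leb R n, forall x, 0 < s x} -> (Ainfty_const s <= a%:E)%E ->
  forall k x, exists2 G : X -> \bar R,
  (forall j y, cell (dyadic lam t) k x y -> (k <= j)%N -> (mean j s y)%:E <= G y)%E &
  (\int[@leb R n]_(y in cell (dyadic lam t) k x) G y <=
   a%:E * \int[@leb R n]_(y in cell (dyadic lam t) k x) (s y)%:E)%E.
Proof.
move=> si spos sa k x; have [ms s0 _] := si.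
have D := dyadic_partition t lam0.
pose Q := dyadic_cube k x.
have mQ : measurable Q by exact: measurable_cube.
have msQ : measurable_fun [set: X] (fun z => s z * \1_Q z).
  by apply: measurable_funM => //; exact: measurable_indic.
exists (hl_maximal (fun y => s y * \1_Q y)) => [j y yx kj|].
  apply: (@le_trans _ _ (avg (dyadic_cube j y) (fun z => (`|(s z * \1_Q z)%R|)%:E))); last first.
    apply: ereal_sup_ubound; exists (dyadic_cube j y) => //; split.
      exact: dyadic_cube_cubes.
    by apply: cell_sub_dyadic_cube.
  rewrite -avg_dyadic_cube// /avg; apply: lee_wpmul2l.
    by rewrite inve_ge0 measure_ge0.
  rewrite -integral_dyadic_cell//.
  apply: (@le_trans _ _ (\int[@leb R n]_(z in cell (dyadic lam t) j y) (`|(s z * \1_Q z)%R|)%:E)%E).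
    rewrite le_eqVlt; apply/orP; left; apply/eqP; apply: eq_integral => z; rewrite inE => zy.
    have Qz : Q z.
      apply: cell_sub_dyadic_cube; rewrite -(cell_eq yx).
      exact: (subset_cell D kj zy).
    by rewrite indicE mem_set// mulr1 ger0_norm.
  apply: ge0_subset_integral.
  - exact: (measurable_cell D).
  - exact: measurable_cube.
  - apply: measurable_funTS; apply/measurable_EFinP.
    exact: (measurableT_comp (@normr_measurable R setT) msQ).
  - by move=> z _; rewrite lee_fin.
  - exact: cell_sub_dyadic_cube.
have G0 y : (0 <= hl_maximal (fun y => s y * \1_Q y)%R y)%E.
  apply: (@le_trans _ _ (avg (dyadic_cube 0 y) (fun z => (`|(s z * \1_Q z)%R|)%:E))).
    rewrite /avg leb_dyadic_cube inver gt_eqF ?(vol_gt0 D)//.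
    apply: mule_ge0; first by rewrite lee_fin invr_ge0 (vol_ge0 D).
    by apply: integral_ge0 => z _; rewrite lee_fin.
  apply: ereal_sup_ubound; exists (dyadic_cube 0 y) => //; split.
    exact: dyadic_cube_cubes.
  exact: cell_sub_dyadic_cube.
have Qpos : (0 < \int[@leb R n]_(y in Q) (s y)%:E)%E.
  rewrite integral_dyadic_cube// lte_fin mulr_gt0 ?(vol_gt0 D)//.
  exact: mean_loc_gt0.
rewrite integral_dyadic_cell//.
apply: (@le_trans _ _ (\int[@leb R n]_(y in Q) hl_maximal (fun y => s y * \1_Q y)%R y)%E).
  rewrite integral_mkcond [leRHS]integral_mkcond; apply: ge0_le_lower_integral.
    by move=> y _; apply: erestrict_ge0.
  move=> y _; rewrite /patch; case: ifPn => [|_]; last by case: ifPn.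
  by rewrite inE => /cell_sub_dyadic_cube yQ; rewrite mem_set.
have : ((\int[@leb R n]_(y in Q) (s y)%:E)^-1 *
   \int[@leb R n]_(y in Q) hl_maximal (fun y => s y * \1_Q y)%R y <= a%:E)%E.
  apply: le_trans sa; apply: ereal_sup_ubound; exists Q => //.
  exact: dyadic_cube_cubes.
move: Qpos; rewrite integral_dyadic_cube// => Qpos; rewrite lte_fin in Qpos.
rewrite inver gt_eqF//.
by rewrite lee_pdivrMl// muleC.
Qed.

End locally_integrable.

(** * Weights of class A_(P,q) *)

(** On a cube the maximal function of the restricted weight is at least its
    mean. *)
Lemma Ainfty_ge1 (R : realType) (n : nat) (s : euclid R n -> R) : loc_integrable s ->
  {ae @leb R n, forall x, 0 < s x} -> (1 <= Ainfty_const s)%E.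
Proof.
move=> si spos; have [ms s0 soo] := si.
pose Q := cube (fun _ : 'I_n => 0 : R) 1.
have mQ : measurable Q by exact: measurable_cube.
have lQ : leb Q = 1%E by rewrite leb_cube// expr1n.
have S0 : (0 < \int[@leb R n]_(x in Q) (s x)%:E)%E.
  apply: integral_ae_gt0 => //.
  suff : (0 < leb Q)%E by [].
  by rewrite lQ.
have Soo := soo (fun=> 0) 1 ltr01.
rewrite -/Q in Soo; set S := (\int[_]_(_ in Q) _)%E in S0 Soo.
have avgS : avg Q (fun y => (`|(s y * \1_Q y)%R|)%:E) = S.
  rewrite /avg lQ inve1 mul1e; apply: eq_integral => y; rewrite inE => Qy.
  by rewrite indicE mem_set// mulr1 ger0_norm.
apply: (@le_trans _ _ (S^-1 * \int[@leb R n]_(y in Q) hl_maximal (fun y => s y * \1_Q y)%R y)%E).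
  apply: (@le_trans _ _ (S^-1 * \int[@leb R n]_(y in Q) (cst S y))%E).
    rewrite integral_cst// [X in (S * X)%E](_ : _ = 1%E)//.
    rewrite mule1; case: S S0 Soo {avgS} => // r r0 _.
    rewrite inver gt_eqF// -EFinM mulVf// gt_eqF//.
  apply: lee_wpmul2l; first by rewrite inve_ge0 ltW.
  apply: ge0_le_lower_integral => y Qy /=; first exact: ltW.
  rewrite -avgS; apply: ereal_sup_ubound; exists Q => //; split=> //.
  exact: cubes_cube.
by apply: ereal_sup_ubound; exists Q => //; exact: cubes_cube.
Qed.

Section weights.
Context (R : realType) (n m : nat) (P : 'I_m -> R) (q : R).
Variable w : 'I_m -> euclid R n -> R.
Hypotheses (P1 : forall i, 1 < P i) (q0 : 0 < q) (wA : APq P q w).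

Local Notation nuq := (fun x => nu w x `^ q).

Lemma conj_exp_gt0 (r : R) : 1 < r -> 0 < conj_exp r.
Proof. by move=> r1; rewrite /conj_exp divr_gt0//; lra. Qed.

Lemma APq_weight_ae i : {ae @leb R n, forall x, 0 < w i x}.
Proof. by have [/(_ i)[]] := wA. Qed.

Lemma nuq_ae : {ae @leb R n, forall x, 0 < nuq x}.
Proof.
have ae_filter := ae_filter_ringOfSetsType (@leb R n).
have w_gt0 := @filter_forall _ _ (fun i x => 0 < w i x) _ ae_filter APq_weight_ae.
apply: (@filterS _ _ ae_filter [set x | forall i, 0 < w i x] _ _ w_gt0) => x wx.
by apply: powR_gt0; rewrite /nu prodr_gt0.
Qed.

Lemma sigma_ae i : {ae @leb R n, forall x, 0 < sigma P w i x}.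
Proof.
have ae_filter := ae_filter_ringOfSetsType (@leb R n).
apply: (@filterS _ _ ae_filter [set x | 0 < w i x] _ _ (APq_weight_ae i)) => x wx.
exact: powR_gt0.
Qed.

Lemma measurable_sigma i : measurable_fun [set: euclid R n] (sigma P w i).
Proof.
have [/(_ i)[_ _ mw _] _] := wA.
exact: (measurableT_comp (measurable_powR _) mw).
Qed.

Lemma measurable_nuq : measurable_fun [set: euclid R n] nuq.
Proof.
have mnu : measurable_fun [set: euclid R n] (nu w).
  by apply: measurable_prod => i _; have [/(_ i)[]] := wA.
exact: (measurableT_comp (measurable_powR q) mnu).
Qed.

Lemma avg_gt0 a l (f : euclid R n -> R) : 0 < l -> measurable_fun [set: euclid R n] f ->
  (forall x, 0 <= f x) -> {ae @leb R n, forall x, 0 < f x} ->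
  (0 < avg (cube a l) (fun x => (f x)%:E))%E.
Proof.
move=> l0 mf f0 fp; have L0 := exprn_gt0 n l0.
rewrite /avg leb_cube// inver gt_eqF//; apply: mule_gt0.
  by rewrite lte_fin invr_gt0.
apply: integral_ae_gt0 => //; first exact: measurable_cube.
suff : (0 < leb (cube a l))%E by [].
by rewrite leb_cube.
Qed.

Lemma avg_lty a l (f : euclid R n -> R) : 0 < l ->
  (avg (cube a l) (fun x => (f x)%:E) < +oo)%E ->
  (\int[@leb R n]_(x in cube a l) (f x)%:E < +oo)%E.
Proof.
move=> l0; have L0 := exprn_gt0 n l0.
rewrite /avg leb_cube// inver gt_eqF//.
case: (\int[_]_(_ in _) _)%E => [r _|/=|]//; first exact: ltry.
by rewrite gt0_muley// lte_fin invr_gt0.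
Qed.

Let avg_nuq_gt0 a l : 0 < l -> (0 < avg (cube a l) (fun x => (nuq x)%:E))%E.
Proof.
by move=> l0; exact: (avg_gt0 a l0 measurable_nuq (fun x => powR_ge0 _ _) nuq_ae).
Qed.

Let avg_sigma_gt0 i a l : 0 < l -> (0 < avg (cube a l) (fun x => (sigma P w i x)%:E))%E.
Proof.
move=> l0.
exact: (avg_gt0 a l0 (measurable_sigma i) (fun x => powR_ge0 _ _) (sigma_ae i)).
Qed.

Let avg_le a l : 0 < l ->
  (avg (cube a l) (fun x => (nuq x)%:E) * \prod_(i < m)
   avg (cube a l) (fun x => (sigma P w i x)%:E) `^ (q / conj_exp (P i)) <= APq_const P q w)%E.
Proof. by move=> l0; apply: ereal_sup_ubound; exists (cube a l) => //; exact: cubes_cube. Qed.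

Let prod_gt0 a l : 0 < l ->
  (0 < \prod_(i < m) avg (cube a l) (fun x => (sigma P w i x)%:E) `^ (q / conj_exp (P i)))%E.
Proof. by move=> l0; apply: prode_gt0 => i; apply/poweR_gt0/avg_sigma_gt0. Qed.

(** Weights are positive almost everywhere, so no factor in the supremum
    vanishes. Positivity of the factors is also what makes each of them finite
    as soon as the product is. *)
Lemma APq_const_gt0 : (0 < APq_const P q w)%E.
Proof.
apply: lt_le_trans (avg_le (fun=> 0) ltr01).
by apply: mule_gt0; [exact: avg_nuq_gt0|exact: prod_gt0].
Qed.

Lemma loc_integrable_nuq : loc_integrable nuq.
Proof.
split=> [|x|a l l0]; first exact: measurable_nuq.
  exact: powR_ge0.
apply: avg_lty => //.
apply: (gt0_mule_ltyl (avg_nuq_gt0 a l0) (prod_gt0 a l0)).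
by apply: le_lt_trans (avg_le a l0) _; have [] := wA.
Qed.

Lemma loc_integrable_sigma i : loc_integrable (sigma P w i).
Proof.
split=> [|x|a l l0]; first exact: measurable_sigma.
  exact: powR_ge0.
apply: avg_lty => //.
have := le_lt_trans (avg_le a l0) (proj2 wA); rewrite muleC.
move/(gt0_mule_ltyl (prod_gt0 a l0) (avg_nuq_gt0 a l0)).
move/gt0_prode_lty => /(_ _ i) h; apply: lty_poweRy (h _).
  by rewrite gt_eqF// divr_gt0// conj_exp_gt0.
by move=> j; apply/poweR_gt0/avg_sigma_gt0.
Qed.

Lemma testing_dyadic lam t : 0 < lam -> forall k x,
  mean (@leb R n) (dyadic lam t) k nuq x *
  \prod_(i < m) mean (@leb R n) (dyadic lam t) k (sigma P w i) x `^ (q - q / P i) <=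
  fine (APq_const P q w).
Proof.
move=> lam0 k x; rewrite -lee_fin fineK; last first.
  by rewrite gt0_fin_numE; [have [] := wA|exact: APq_const_gt0].
apply: le_trans (avg_le (dyadic_corner lam t k x) (side_gt0 lam0 k)).
rewrite EFinM -prodEFin -[X in avg X]/(dyadic_cube lam t k x).
rewrite (avg_dyadic_cube t lam0 k x loc_integrable_nuq).
rewrite le_eqVlt; apply/orP; left; apply/eqP; congr (_ * _)%E.
apply: eq_bigr => i _; rewrite (avg_dyadic_cube t lam0 k x (loc_integrable_sigma i)).
rewrite poweR_EFin; congr (_ `^ _)%:E; have := P1 i => Pi.
by rewrite /conj_exp; field; rewrite !gt_eqF//; lra.
Qed.

End weights.

(** * Pointwise domination of the fractional maximal operator *)

Section pointwise.
Context (R : realType) (n m : nat) (alpha q : R) (f : 'I_m -> euclid R n -> R).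
Hypotheses (n0 : (0 < n)%N) (m0 : (0 < m)%N) (q0 : 0 < q).
Hypothesis alpha_mn : 0 < alpha < (m * n)%:R.
Hypothesis fi : forall i, loc_integrable (f i).

Definition dyadic_prod lam t k (x : euclid R n) :=
  vol (@leb R n) (dyadic lam t) k x `^ (alpha / n%:R) *
  \prod_(i < m) mean (@leb R n) (dyadic lam t) k (f i) x.

(** The factor lost when a cube is replaced by a cell whose side is at most 6
    times as long. *)
Definition grid_loss : R := ((6 ^+ n) `^ (1 - alpha / (m * n)%:R)) ^+ m.

(** The factor lost when a cell is replaced by the selected cell above it. *)
Definition stop_loss : R := m.*2%:R ^+ m.

Local Notation stop lam t := (stop (@leb R n) (dyadic lam t) f).

Lemma dyadic_prod_ge0 lam t k x : 0 < lam -> 0 <= dyadic_prod lam t k x.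
Proof.
move=> lam0; rewrite mulr_ge0 ?powR_ge0//; apply: prodr_ge0 => i _.
by apply: (mean_ge0 (dyadic_partition t lam0)); case: (fi i).
Qed.

(** Passing to the cell increases the integrals. The power of the volume is
    negative, but the volume grows at most by the factor [6 ^+ n]. *)
Lemma cube_le_dyadic_prod a l lam t k x : 0 < l -> 0 < lam ->
  lam / 2 ^+ k <= 6 * l -> cube a l `<=` cell (dyadic lam t) k x ->
  \prod_(i < m) (((l ^+ n) `^ (1 - alpha / (m * n)%:R))^-1 *
      fine (\int[@leb R n]_(y in cube a l) (f i y)%:E)) <=
  grid_loss * dyadic_prod lam t k x.
Proof.
move=> l0 lam0 w6 Qc; have D := dyadic_partition t lam0.
set V := vol (@leb R n) (dyadic lam t) k x.
have V0 : 0 < V by exact: vol_gt0.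
set g := alpha / (m * n)%:R.
have mn0 : 0 < (m * n)%:R :> R by rewrite ltr0n muln_gt0 m0.
have g1 : 0 < g < 1.
  by case/andP: alpha_mn => h1 h2; rewrite divr_gt0//= ltr_pdivrMr// mul1r.
have L0 := exprn_gt0 n l0.
have VL : V <= 6 ^+ n * l ^+ n.
  rewrite /V dyadic_vol// -exprMn; apply: lerXn2r => //.
  - by rewrite nnegrE ltW// side_gt0.
  - by rewrite nnegrE mulr_ge0// ltW.
have -> : grid_loss * dyadic_prod lam t k x =
    \prod_(i < m) ((6 ^+ n) `^ (1 - g) * V `^ g * mean (@leb R n) (dyadic lam t) k (f i) x).
  rewrite big_split/= prodr_const card_ord /grid_loss /dyadic_prod -/V -/g mulrA; congr (_ * _).
  rewrite exprMn; congr (_ * _).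
  rewrite -powR_mulrn ?powR_ge0// -powRrM; congr (_ `^ _).
  rewrite /g natrM; field.
  by rewrite !pnatr_eq0 -!lt0n m0 n0.
apply: ler_prod => i _; apply/andP; split.
  rewrite mulr_ge0 ?invr_ge0 ?powR_ge0// fine_ge0// integral_ge0// => y _.
  by rewrite lee_fin; case: (fi i).
have fV : fine (\int[@leb R n]_(y in cube a l) (f i y)%:E) <=
    mean (@leb R n) (dyadic lam t) k (f i) x * V.
  have [mf f0 fl] := fi i.
  rewrite -lee_fin fineK; last first.
    rewrite ge0_fin_numE ?fl//; apply: integral_ge0 => y _.
    by rewrite lee_fin.
  rewrite -(integral_cellE D)//; last exact: cell_integrable_loc.
  apply: ge0_subset_integral.
  - exact: measurable_cube.
  - exact: (measurable_cell D).
  - by apply: measurable_funTS; apply/measurable_EFinP; exact: mf.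
  - by move=> y _; rewrite lee_fin.
  - exact: Qc.
apply: (le_trans (ler_wpM2l _ fV)); first by rewrite invr_ge0 powR_ge0.
rewrite mulrCA [leRHS]mulrC; apply: ler_wpM2l.
  by apply: mean_ge0 => // y; case: (fi i).
rewrite ler_pdivrMl ?powR_gt0//.
have {1}-> : V = V `^ g * V `^ (1 - g).
  by rewrite -gt0_powRD// addrC subrK powRr1// ltW.
rewrite [leRHS]mulrA [leRHS]mulrC; apply: ler_wpM2l; first exact: powR_ge0.
have E6 : 0 <= 6 ^+ n :> R by exact: exprn_ge0.
rewrite [leRHS]mulrC -powRM ?(ltW L0)//.
case/andP: g1 => g_gt0 g_lt1.
by apply: ge0_ler_powR; rewrite ?nnegrE ?mulr_ge0 ?(ltW V0) ?(ltW L0)//; lra.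
Qed.

(** By [mean_stop] the product of the means loses at most [stop_loss] on passing
    to the selected cell above, and the power of the volume, being positive,
    increases. *)
Lemma dyadic_prod_le_stop lam t k N x : 0 < lam -> (k <= N)%N ->
  dyadic_prod lam t k x `^ q <= stop_loss `^ q *
  \sum_(j < N.+1) (stop lam t j x == j)%:R * dyadic_prod lam t j x `^ q.
Proof.
move=> lam0 kN; have D := dyadic_partition t lam0.
have ci i : cell_integrable (@leb R n) (dyadic lam t) (f i) by exact: cell_integrable_loc.
have an0 : 0 <= alpha / n%:R by case/andP: alpha_mn => h _; rewrite divr_ge0// ltW.
set s := stop lam t k x.
have sk : (s <= k)%N by exact: stop_le.
have v0 j := dyadic_prod_ge0 t j x lam0.
have sl : dyadic_prod lam t k x <= stop_loss * dyadic_prod lam t s x.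
  rewrite /stop_loss /dyadic_prod mulrCA.
  have -> : m.*2%:R ^+ m = \prod_(i < m) m.*2%:R :> R.
    by rewrite prodr_const card_ord.
  rewrite -big_split/=.
  apply: ler_pM.
  - exact: powR_ge0.
  - by apply: prodr_ge0 => i _; apply: mean_ge0 => // y; case: (fi i).
  - by apply: ge0_ler_powR; rewrite ?nnegrE ?(vol_ge0 D)//; exact: vol_le.
  apply: ler_prod => i _; rewrite mean_ge0//=; last by move=> y; case: (fi i).
  exact: mean_stop.
apply: (@le_trans _ _ ((stop_loss * dyadic_prod lam t s x) `^ q)).
  apply: ge0_ler_powR; rewrite ?nnegrE ?(ltW q0)//.
  by rewrite mulr_ge0// exprn_ge0.
rewrite powRM ?exprn_ge0//; apply: ler_wpM2l; first exact: powR_ge0.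
have sN : (s < N.+1)%N by rewrite ltnS (leq_trans sk).
rewrite (bigD1 (Ordinal sN))//= stop_idem eqxx mul1r lerDl.
by apply: sumr_ge0 => j _; rewrite mulr_ge0// powR_ge0.
Qed.

(** The coarsest side [3 * 2 ^+ N] and the number of generations grow together,
    so that a cube of any size is eventually covered: generation [k] handles the
    sides between [2 ^+ N / 2 ^+ k] and half of it. *)
Definition majorant N (x : euclid R n) : R :=
  (grid_loss * stop_loss) `^ q *
  \sum_(t : {ffun 'I_n -> bool}) \sum_(k < N.*2.+1)
    (stop (3 * 2 ^+ N) t k x == k)%:R * dyadic_prod (3 * 2 ^+ N) t k x `^ q.

Lemma three_pow_gt0 N : 0 < 3 * 2 ^+ N :> R.
Proof. by rewrite mulr_gt0// exprn_gt0. Qed.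

Lemma cube_le_majorant a l x : 0 < l -> cube a l x ->
  exists N0, forall N, (N0 <= N)%N ->
  (\prod_(i < m) (((l ^+ n) `^ (1 - alpha / (m * n)%:R))^-1 *
      fine (\int[@leb R n]_(y in cube a l) (f i y)%:E))) `^ q <= majorant N x.
Proof.
move=> l0 Qx; have [N0 hN0] := dyadic_scale l0; exists N0 => N /hN0[k kN /andP[h1 h2]].
set lam : R := 3 * 2 ^+ N; have lam0 : 0 < lam by exact: three_pow_gt0.
have E2 := exprn_gt0 k (ltr0n R 2).
have lamE : lam / 2 ^+ k = 3 * (2 ^+ N / 2 ^+ k) by rewrite /lam mulrA.
have [|t ht] := @cube_sub_dyadic_cell R n lam l k a lam0.
  by rewrite l0 lamE/= mulrC mulKf.
have h6 : lam / 2 ^+ k <= 6 * l by rewrite lamE; lra.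
have := cube_le_dyadic_prod l0 lam0 h6 (ht _ Qx).
set tau := \prod_(i < m) _ => htau.
have tau0 : 0 <= tau.
  apply: prodr_ge0 => i _; rewrite mulr_ge0 ?invr_ge0 ?powR_ge0// fine_ge0//.
  by apply: integral_ge0 => y _; rewrite lee_fin; case: (fi i).
have gl0 : 0 <= grid_loss by rewrite exprn_ge0// powR_ge0.
have sl0 : 0 <= stop_loss by rewrite exprn_ge0.
have v0 t' k' := dyadic_prod_ge0 t' k' x lam0.
apply: (@le_trans _ _ ((grid_loss * dyadic_prod lam t k x) `^ q)).
  apply: ge0_ler_powR => //; [exact: ltW|rewrite nnegrE; exact: mulr_ge0].
rewrite powRM// /majorant powRM// -mulrA; apply: ler_wpM2l; first exact: powR_ge0.
apply: (le_trans (dyadic_prod_le_stop t x lam0 kN)).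
apply: ler_wpM2l; first exact: powR_ge0.
rewrite (bigD1 t)//= lerDl; apply: sumr_ge0 => t' _.
by apply: sumr_ge0 => j _; rewrite mulr_ge0// powR_ge0.
Qed.

End pointwise.

(** * The inequality when all norms are positive and finite *)

Section finite_norms.
Context (R : realType) (n m : nat) (P : 'I_m -> R) (p alpha q : R).
Variables (w f : 'I_m -> euclid R n -> R).
Hypotheses (n0 : (0 < n)%N) (m0 : (0 < m)%N) (P1 : forall i, 1 < P i).
Hypotheses (pE : p^-1 = \sum_(i < m) (P i)^-1) (qE : q^-1 = p^-1 - alpha / n%:R).
Hypotheses (p0 : 0 < p) (pq : p <= q).
Hypothesis alpha_mn : 0 < alpha < (m * n)%:R.
Hypothesis wA : APq P q w.
Hypothesis mf : forall i, measurable_fun [set: euclid R n] (f i).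

Let q0 : 0 < q. Proof. exact: lt_le_trans pq. Qed.

Let mw i : measurable_fun [set: euclid R n] (w i).
Proof. by have [/(_ i)[]] := wA. Qed.

Let w0 i x : 0 <= w i x. Proof. by have [/(_ i)[]] := wA. Qed.

Local Notation F := (fun i x => `|f i x|).
Local Notation W := (fun i x => `|f i x| `^ P i * w i x `^ P i).

Lemma measurable_weighted_power i : measurable_fun [set: euclid R n] (W i).
Proof.
apply: measurable_funM.
  have ma : measurable_fun [set: euclid R n] (F i).
    exact: (measurableT_comp (@normr_measurable R setT) (mf i)).
  exact: (measurableT_comp (measurable_powR (P i)) ma).
exact: (measurableT_comp (measurable_powR (P i)) (mw i)).
Qed.

Lemma loc_integrable_norm i : (\int[@leb R n]_x (W i x)%:E < +oo)%E ->
  loc_integrable (F i).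
Proof.
move=> Woo; split=> [|x|a l l0].
- exact: (measurableT_comp (@normr_measurable R setT) (mf i)).
- exact: normr_ge0.
have mc := measurable_cube a l.
apply: (integral_abs_lty (P1 i) mc (APq_weight_ae wA i) (mw i) (mf i)).
  by have [_ _ ->] := loc_integrable_sigma P1 q0 wA i.
apply: le_lt_trans Woo; apply: ge0_subset_integral.
- exact: mc.
- exact: measurableT.
- by apply/measurable_EFinP; exact: measurable_weighted_power.
- by move=> x _; rewrite lee_fin mulr_ge0// powR_ge0.
- exact: subsetT.
Qed.

Variables (I a : 'I_m -> R).
Hypothesis I0 : forall i, 0 < I i.
Hypothesis IW : forall i, (\int[@leb R n]_x (W i x)%:E = (I i)%:E)%E.
Hypothesis aE : forall i, Ainfty_const (sigma P w i) = (a i)%:E.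

Let fl i : loc_integrable (F i).
Proof. by apply: loc_integrable_norm; rewrite IW ltry. Qed.

Let sl i := loc_integrable_sigma P1 q0 wA i.

Let a1 i : 1 <= a i.
Proof.
by rewrite -lee_fin -aE; exact: (Ainfty_ge1 (sl i) (sigma_ae wA i)).
Qed.

Definition norm_bound := fine (APq_const P q w) *
  \prod_(i < m) (I i / ((P i - 1) * 2^-1 `^ P i * (2 * a i)^-1)) `^ (q / P i).

Lemma sparse_sum_bound lam t N : 0 < lam ->
  (\sum_(k < N.+1) \int[@leb R n]_x
     ((stop (@leb R n) (dyadic lam t) F k x == k)%:R *
      (dyadic_prod alpha F lam t k x) `^ q * nu w x `^ q)%:E <= norm_bound%:E)%E.
Proof.
move=> lam0; have D := dyadic_partition t lam0.
have fi i : cell_integrable (@leb R n) (dyadic lam t) (F i).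
  exact: cell_integrable_loc.
have si i : cell_integrable (@leb R n) (dyadic lam t) (sigma P w i).
  exact: cell_integrable_loc.
have g_gt0 i k x : 0 < mean (@leb R n) (dyadic lam t) k (sigma P w i) x.
  by apply: mean_loc_gt0 => //; exact: sigma_ae wA i.
apply: (@dyadic_bound _ _ _ _ _ D m P F (sigma P w)
  (fun x => nu w x `^ q) (fun i x => (W i x)%:E) a I p q
  (alpha / n%:R) _ P1 pE qE p0 pq fi si _ g_gt0).
- exact: (cell_integrable_loc t lam0 (loc_integrable_nuq wA)).
- by apply: fine_ge0; apply/ltW; exact: (APq_const_gt0 wA).
- exact: (testing_dyadic P1 q0 wA t lam0).
- by move=> i; apply/measurable_EFinP; exact: measurable_weighted_power.
- by move=> i x; rewrite lee_fin mulr_ge0// powR_ge0.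
- exact: IW.
- exact: I0.
- exact: a1.
- move=> i k x.
  exact: (holder_testing (P1 i) (measurable_cell D k x) (APq_weight_ae wA i) (mw i) (mf i)
    (mean_ge0 D k x (fun y => normr_ge0 (f i y))) (g_gt0 i k x) (vol_gt0 D k x)
    (integral_cellE D k x (fi i)) (integral_cellE D k x (si i))).
- move=> i; have ai : (Ainfty_const (sigma P w i) <= (a i)%:E)%E by rewrite aE.
  exact: (Ainfty_dominate t lam0 (sl i) (sigma_ae wA i) ai).
Qed.

Lemma term_constant lam t k : 0 < lam -> cell_constant (dyadic lam t) k
  (fun x => (stop (@leb R n) (dyadic lam t) F k x == k)%:R *
    dyadic_prod alpha F lam t k x `^ q).
Proof.
move=> lam0 x y e; have D := dyadic_partition t lam0.
rewrite (stop_constant D _ e) /dyadic_prod (vol_constant _ e).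
by under eq_bigr do rewrite (mean_constant _ _ e).
Qed.

Lemma measurable_majorant N :
  measurable_fun [set: euclid R n] (majorant alpha q F N).
Proof.
have mterm (t : {ffun 'I_n -> bool}) (k : 'I_N.*2.+1) : measurable_fun [set: euclid R n]
    (fun x => (stop (@leb R n) (dyadic (3 * 2 ^+ N) t) F k x == k)%:R *
      dyadic_prod alpha F (3 * 2 ^+ N) t k x `^ q).
  exact: (measurable_cell_constant (dyadic_partition t (three_pow_gt0 R N)) measurableT
    (term_constant (three_pow_gt0 R N) (k := k))).
exact: (measurable_funM (measurable_cst _)
  (measurable_sum _ (fun t => measurable_sum _ (mterm t)))).
Qed.

Lemma integral_majorant N :
  (\int[@leb R n]_x (majorant alpha q F N x * nu w x `^ q)%:E <=
   ((grid_loss n m alpha * stop_loss R m) `^ q *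
     (#|{: {ffun 'I_n -> bool}}|%:R * norm_bound))%:E)%E.
Proof.
set lam : R := 3 * 2 ^+ N; have lam0 : 0 < lam by exact: three_pow_gt0.
pose h (t : {ffun 'I_n -> bool}) k x := (stop (@leb R n) (dyadic lam t) F k x == k)%:R *
  dyadic_prod alpha F lam t k x `^ q * nu w x `^ q.
have h0 t k x : 0 <= h t k x by rewrite !mulr_ge0 ?powR_ge0.
have mh t k : measurable_fun [set: euclid R n] (h t k).
  exact: (measurable_funM (measurable_cell_constant (dyadic_partition t lam0) measurableT
    (term_constant lam0 (k := k))) (measurable_nuq wA)).
have mhE t k : measurable_fun [set: euclid R n] (EFin \o h t k).
  by apply/measurable_EFinP; exact: mh.
pose c := (grid_loss n m alpha * stop_loss R m) `^ q.
have c0 : 0 <= c by exact: powR_ge0.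
rewrite (_ : (\int[_]_x _)%E = \int[@leb R n]_x
    (c%:E * \sum_(t : {ffun 'I_n -> bool}) \sum_(k < N.*2.+1) (h t k x)%:E)%E)%E; last first.
  apply: eq_integral => x _; rewrite /majorant -/c -mulrA EFinM; congr (_ * _)%E.
  rewrite mulr_suml -sumEFin; apply: eq_bigr => t _.
  by rewrite mulr_suml -sumEFin.
have hE0 t (k : 'I_N.*2.+1) x : setT x -> (0 <= (h t k x)%:E)%E by rewrite lee_fin.
have sE0 t x : setT x -> (0 <= \sum_(k < N.*2.+1) (h t k x)%:E)%E.
  by move=> _; apply: sume_ge0 => k _; exact: hE0.
have ms t : measurable_fun [set: euclid R n]
    (fun x => (\sum_(k < N.*2.+1) (h t k x)%:E)%E).
  exact: (emeasurable_sum _ (fun k : 'I_N.*2.+1 => mhE t k)).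
rewrite (ge0_integralZl_EFin _ measurableT _ (emeasurable_sum _ ms) c0); last first.
  by move=> x _; apply: sume_ge0 => t _; exact: sE0.
rewrite [leRHS]EFinM; apply: lee_wpmul2l; first by rewrite lee_fin.
rewrite (ge0_integral_sum _ measurableT ms sE0).
apply: (@le_trans _ _ (\sum_(t : {ffun 'I_n -> bool}) norm_bound%:E)%E).
  apply: lee_sum => t _.
  rewrite (ge0_integral_sum _ measurableT (fun k : 'I_N.*2.+1 => mhE t k) (hE0 t)).
  exact: sparse_sum_bound.
by rewrite sumEFin sumr_const mulr_natl.
Qed.

Lemma frac_maximal_termE b l : 0 < l ->
  (\prod_(i < m) ((leb (cube b l) `^ (1 - alpha / (m * n)%:R))^-1 *
       \int[@leb R n]_(y in cube b l) `|f i y|%:E) =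
   (\prod_(i < m) (((l ^+ n) `^ (1 - alpha / (m * n)%:R))^-1 *
      fine (\int[@leb R n]_(y in cube b l) (F i y)%:E)))%:E)%E.
Proof.
move=> l0; rewrite -prodEFin; apply: eq_bigr => i _.
rewrite leb_cube// poweR_EFin inver gt_eqF ?powR_gt0 ?exprn_gt0//.
rewrite EFinM fineK// ge0_fin_numE; last first.
  by apply: integral_ge0 => y _; rewrite lee_fin.
by have [_ _ ->] := fl i.
Qed.

(** Each cube containing [x] is dominated by the majorants of all large stages,
    hence by their limit inferior, and so is the supremum over all cubes. *)
Lemma frac_maximal_le_liminf x :
  (`|frac_maximal alpha f x| `^ q * (nu w x `^ q)%:E <=
   limn_einf (fun N => (majorant alpha q F N x * nu w x `^ q)%:E))%E.
Proof.
have M0 N : 0 <= majorant alpha q F N x.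
  rewrite mulr_ge0 ?powR_ge0// sumr_ge0// => t _; rewrite sumr_ge0// => k _.
  by rewrite mulr_ge0// powR_ge0.
set c := nu w x `^ q; have c0 : 0 <= c by exact: powR_ge0.
set z := limn_einf _.
have z0 : (0 <= z)%E.
  by apply: (limn_einf_ge (n := 0)) => k _; rewrite lee_fin mulr_ge0.
have [->|cn0] := eqVneq c 0; first by rewrite mule0.
have cpos : 0 < c by rewrite lt_neqAle eq_sym cn0.
have Mx0 : (0 <= frac_maximal alpha f x)%E.
  pose b i := ecoord x i.
  have xQ : cube b 1 x by move=> i; rewrite lexx/= lerDl.
  apply: le_trans (ereal_sup_ubound _); last first.
    exists (cube b 1) => //; split=> //; exact: cubes_cube.
  by apply: prode_ge0 => i _; apply: mule_ge0;
    [rewrite inve_ge0 poweR_ge0|apply: integral_ge0 => y _; rewrite lee_fin].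
rewrite gee0_abs//.
rewrite -/z; case zE : z z0 => [r| |]//; last by move=> _; rewrite leey.
rewrite lee_fin => r0.
have : (frac_maximal alpha f x <= ((r / c) `^ q^-1)%:E)%E.
  apply: ge_ereal_sup => _ [Q [Qc Qx] <-].
  have /cubesP[b [l [l0 QE]]] := Qc.
  rewrite QE frac_maximal_termE// lee_fin.
  have Qx' : cube b l x by rewrite -QE.
  have [N0 hN] := cube_le_majorant n0 m0 q0 alpha_mn fl l0 Qx'.
  set tau := \prod_(i < m) _ in hN *.
  have tau0 : 0 <= tau.
    apply: prodr_ge0 => i _; rewrite mulr_ge0 ?invr_ge0 ?powR_ge0// fine_ge0//.
    by apply: integral_ge0 => y _; rewrite lee_fin.
  have : tau `^ q <= r / c.
    rewrite ler_pdivlMr// -lee_fin -zE; apply: (limn_einf_ge (n := N0)) => k /hN h.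
    by rewrite lee_fin; apply: ler_wpM2r.
  move=> h; have {1}-> : tau = (tau `^ q) `^ q^-1.
    by rewrite -powRrM divff ?powRr1// gt_eqF.
  by apply: ge0_ler_powR; rewrite ?nnegrE ?invr_ge0 ?powR_ge0 ?divr_ge0 ?(ltW q0)// ltW.
move: Mx0; case: (frac_maximal alpha f x) => [s| |]//.
rewrite poweR_EFin -EFinM !lee_fin => s0 sr; rewrite -ler_pdivlMr//.
have -> : r / c = ((r / c) `^ q^-1) `^ q.
  by rewrite -powRrM mulVf ?powRr1// ?divr_ge0 ?(ltW cpos)// gt_eqF.
by apply: ge0_ler_powR; rewrite ?nnegrE ?powR_ge0 ?(ltW q0).
Qed.

Lemma frac_maximal_bound :
  (\int[@leb R n]_x (`|frac_maximal alpha f x| `^ q * (nu w x `^ q)%:E) <=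
   ((grid_loss n m alpha * stop_loss R m) `^ q *
     (#|{: {ffun 'I_n -> bool}}|%:R * norm_bound))%:E)%E.
Proof.
have M0 N x : 0 <= majorant alpha q F N x.
  rewrite mulr_ge0 ?powR_ge0// sumr_ge0// => t _; rewrite sumr_ge0// => k _.
  by rewrite mulr_ge0// powR_ge0.
apply: (@le_trans _ _ (\int[@leb R n]_x
   limn_einf (fun N => (majorant alpha q F N x * nu w x `^ q)%:E))%E).
  apply: ge0_le_lower_integral => x _; last exact: frac_maximal_le_liminf.
  by apply: mule_ge0; rewrite ?poweR_ge0 ?lee_fin ?powR_ge0.
have mM N : measurable_fun [set: euclid R n]
    (fun x => (majorant alpha q F N x * nu w x `^ q)%:E).
  apply/measurable_EFinP.
  exact: (measurable_funM (measurable_majorant N) (measurable_nuq wA)).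
have posM N x : setT x -> (0 <= (majorant alpha q F N x * nu w x `^ q)%:E)%E.
  by move=> _; rewrite lee_fin mulr_ge0// powR_ge0.
apply: (le_trans (fatou _ measurableT mM posM)).
by apply: limn_einf_le => N; exact: integral_majorant.
Qed.

End finite_norms.

(** * The theorem *)

Lemma frac_maximal_eq0 (R : realType) (n m : nat) (alpha : R) (f : 'I_m -> euclid R n -> R) i :
  (0 < m)%N ->
  (forall a l, 0 < l -> (\int[@leb R n]_(x in cube a l) `|f i x|%:E = 0)%E) ->
  forall x, frac_maximal alpha f x = 0%E.
Proof.
move=> m0 fi x; rewrite /frac_maximal (_ : image _ _ = [set 0%E]) ?ereal_sup1//.
apply/seteqP; split=> [_ [Q [/cubesP[a [l [l0 QE]]] _] <-]|_ ->] /=.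
  by rewrite (bigD1 i)//= QE fi// mule0 mul0e.
have xQ : cube (ecoord x) 1 x by move=> j; rewrite lexx/= lerDl.
exists (cube (ecoord x) 1); first by split=> //; exact: cubes_cube.
by rewrite (bigD1 i)//= fi// mule0 mul0e.
Qed.

Lemma norm_bound_root (R : realType) (m : nat) (P I a D : 'I_m -> R) (q c K : R) :
  (forall i, 0 < P i) -> (forall i, 0 < I i) -> (forall i, 0 < a i) -> (forall i, 0 < D i) ->
  0 < q -> 0 <= c -> 0 <= K ->
  (c * (K * \prod_(i < m) (I i / (D i * (2 * a i)^-1)) `^ (q / P i))) `^ q^-1 =
  (c `^ q^-1 * \prod_(i < m) (2 / D i) `^ (P i)^-1) * K `^ q^-1 *
  \prod_(i < m) a i `^ (P i)^-1 * \prod_(i < m) I i `^ (P i)^-1.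
Proof.
move=> P0 I0 a0 D0 q0 c0 K0.
have pr0 : 0 <= \prod_(i < m) (I i / (D i * (2 * a i)^-1)) `^ (q / P i).
  by apply: prodr_ge0 => i _; exact: powR_ge0.
rewrite powRM ?mulr_ge0// powRM// powR_prod; last by move=> i; exact: powR_ge0.
rewrite (eq_bigr (fun i => (2 / D i) `^ (P i)^-1 * (a i `^ (P i)^-1 * I i `^ (P i)^-1))).
  by rewrite !big_split/=; ring.
move=> i _; rewrite -powRrM.
have -> : q / P i * q^-1 = (P i)^-1 by field; rewrite !gt_eqF.
have -> : I i / (D i * (2 * a i)^-1) = 2 / D i * (a i * I i).
  by field; rewrite !gt_eqF.
have d0 : 0 <= 2 / D i by rewrite divr_ge0// ltW.
have [ai Ii] := (ltW (a0 i), ltW (I0 i)).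
by rewrite (powRM _ d0 (mulr_ge0 ai Ii)) (powRM _ ai Ii).
Qed.

Theorem corollary1p3 (R : realType) (n m : nat) (P : 'I_m -> R)
    (p alpha q : R) :
  (1 <= n)%N -> (1 <= m)%N ->
  (forall i, 1 < P i) ->
  p^-1 = \sum_(i < m) (P i)^-1 ->
  0 < alpha < (m * n)%:R ->
  m%:R^-1 < p < n%:R / alpha ->
  q^-1 = p^-1 - alpha / n%:R ->
  exists C : R, forall w : 'I_m -> euclid R n -> R, APq P q w ->
    forall f : 'I_m -> euclid R n -> R,
    (forall i, measurable_fun [set: euclid R n] (f i)) ->
    (wnorm q (fun x => nu w x `^ q)%R (frac_maximal alpha f) <=
     C%:E * APq_const P q w `^ q^-1 *
     \prod_(i < m) Ainfty_const (sigma P w i) `^ (P i)^-1 *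
     \prod_(i < m) wnorm (P i) (fun x => w i x `^ P i)%R (fun x => (f i x)%:E))%E.
Proof.
move=> n0 m0 P1 pE alpha_mn /andP[mp pna] qE.
have P0 i : 0 < P i by exact: lt_trans (P1 i).
have alpha0 : 0 < alpha by case/andP: alpha_mn.
have nR : 0 < n%:R :> R by rewrite ltr0n.
have p0 : 0 < p by apply: lt_trans mp; rewrite invr_gt0 ltr0n.
have qV0 : 0 < q^-1.
  rewrite qE subr_gt0 ltr_pdivrMr// ltr_pdivlMl//.
  by move: pna; rewrite ltr_pdivlMr.
have q0 : 0 < q by rewrite -invr_gt0.
have pq : p <= q.
  rewrite -lef_pV2 ?posrE// qE lerBlDr lerDl divr_ge0// ltW//.
pose D i := (P i - 1) * 2^-1 `^ P i.
have D0 i : 0 < D i.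
  by apply: mulr_gt0; [rewrite subr_gt0|rewrite powR_gt0 ?invr_gt0].
pose c := (grid_loss n m alpha * stop_loss R m) `^ q * #|{: {ffun 'I_n -> bool}}|%:R.
have c0 : 0 < c.
  apply: mulr_gt0; last first.
    by rewrite ltr0n; apply/card_gt0P; exists [ffun => true].
  apply: powR_gt0; apply: mulr_gt0; last by apply: exprn_gt0; rewrite ltr0n double_gt0.
  by apply: exprn_gt0; apply: powR_gt0; exact: exprn_gt0.
pose C := c `^ q^-1 * \prod_(i < m) (2 / D i) `^ (P i)^-1.
have C0 : 0 < C.
  apply: mulr_gt0; first exact: powR_gt0.
  by apply: prodr_gt0 => i _; rewrite powR_gt0// divr_gt0.
exists C => w wA f mf.
pose K := APq_const P q w.
have K0 : (0 < K)%E := APq_const_gt0 wA.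
have Koo : (K < +oo)%E by have [] := wA.
pose A i := Ainfty_const (sigma P w i).
have A1 i : (1 <= A i)%E.
  exact: (Ainfty_ge1 (loc_integrable_sigma P1 q0 wA i) (sigma_ae wA i)).
pose I i := (\int[@leb R n]_x (`|f i x| `^ P i * w i x `^ P i)%:E)%E.
have I0 i : (0 <= I i)%E.
  by apply: integral_ge0 => x _; rewrite lee_fin mulr_ge0// powR_ge0.
have normE i : wnorm (P i) (fun x => w i x `^ P i)%R (fun x => (f i x)%:E) =
    (I i `^ (P i)^-1)%E.
  by rewrite /wnorm; congr (_ `^ _)%E; apply: eq_integral => x _;
    rewrite poweR_EFin -EFinM.
under [X in (_ <= _ * X)%E]eq_bigr do rewrite normE.
rewrite -/K; under [X in (_ <= _ * X * _)%E]eq_bigr do rewrite -/(A _).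
(* If some f_i vanishes almost everywhere, the maximal function is zero.
   Otherwise every factor on the right is positive, so that an infinite factor
   makes the right-hand side infinite. *)
have [[i Ii]|Ineq0] := pselect (exists i, I i = 0%E).
  rewrite /wnorm (_ : (\int[_]_x _)%E = 0%E).
    rewrite poweR0r ?gt_eqF//; apply: mule_ge0; last first.
      by apply: prode_ge0 => j _; exact: poweR_ge0.
    apply: mule_ge0; last by apply: prode_ge0 => j _; exact: poweR_ge0.
    by apply: mule_ge0; [rewrite lee_fin ltW|exact: poweR_ge0].
  apply: integral0_eq => x _; rewrite (@frac_maximal_eq0 _ _ _ alpha f i m0)//.
    by rewrite abse0 poweR0r ?gt_eqF// mul0e.
  move=> b l l0.
  have wi : weight (w i) by have [/(_ i)] := wA.
  have [wi0 _ mwi _] := wi.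
  have mb := measurable_cube b l.
  have W0 : (\int[@leb R n]_(y in cube b l) (`|f i y| `^ P i * w i y `^ P i)%:E <= 0)%E.
    rewrite -Ii; apply: ge0_subset_integral.
    - exact: mb.
    - exact: measurableT.
    - by apply/measurable_EFinP; exact: measurable_weighted_power wA mf i.
    - by move=> y _; rewrite lee_fin mulr_ge0// powR_ge0.
    - exact: subsetT.
  have [ms s0 soo] := loc_integrable_sigma P1 q0 wA i.
  have fl : loc_integrable (fun y => `|f i y|).
    have Wlt : (I i < +oo)%E by rewrite Ii.
    exact: (loc_integrable_norm P1 p0 pq wA mf Wlt).
  have [_ _ foo] := fl.
  have F0 : (0 <= \int[@leb R n]_(x in cube b l) `|f i x|%:E)%E.
    by apply: integral_ge0 => y _; rewrite lee_fin.
  have S0 : (0 < \int[@leb R n]_(x in cube b l) (sigma P w i x)%:E)%E.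
    apply: integral_ae_gt0 => //; last exact: sigma_ae wA i.
    suff : (0 < leb (cube b l))%E by [].
    by rewrite leb_cube// lte_fin exprn_gt0.
  have := foo b l l0; have := soo b l l0; move: F0 S0.
  case FE : (\int[@leb R n]_(x in cube b l) `|f i x|%:E)%E => [F| |]//.
  case SE : (\int[@leb R n]_(x in cube b l) (sigma P w i x)%:E)%E => [S| |]//.
  rewrite lee_fin lte_fin => F0 S0 _ _; congr (_%:E); apply/eqP; rewrite eq_le F0 andbT.
  have := holder_testing (P1 i) mb (APq_weight_ae wA i) mwi (mf i) F0 S0 ltr01.
  rewrite !mulr1 => /(_ FE SE) h.
  have := le_trans h W0; rewrite lee_fin leNgt; apply: contraNT.
  by rewrite -ltNge => F1; rewrite mulr_gt0// powR_gt0// divr_gt0.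
have Ipos i : (0 < I i)%E.
  rewrite lt_neqAle I0 andbT; apply/eqP => e; apply: Ineq0; exists i; exact/esym.
have Apos i : (0 < A i)%E by exact: lt_le_trans (A1 i).
have CK0 : (0 < C%:E * K `^ q^-1)%E by apply: mule_gt0 => //; exact: poweR_gt0.
have pA0 : (0 < \prod_(i < m) A i `^ (P i)^-1)%E by apply: prode_gt0 => i; exact: poweR_gt0.
have pI0 : (0 < \prod_(i < m) I i `^ (P i)^-1)%E by apply: prode_gt0 => i; exact: poweR_gt0.
have PVn0 i : (P i)^-1 != 0 by rewrite invr_neq0// gt_eqF.
have [[i Ii]|Ifin] := pselect (exists i, I i = +oo%E).
  rewrite [X in (_ <= _ * X)%E](gt0_prode_y (i := i)); last 2 first.
  - by move=> j; exact: poweR_gt0.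
  - by rewrite Ii poweRyr.
  by rewrite gt0_muley ?leey// mule_gt0.
have [[i Ai]|Afin] := pselect (exists i, A i = +oo%E).
  rewrite [X in (_ <= _ * X * _)%E](gt0_prode_y (i := i)); last 2 first.
  - by move=> j; exact: poweR_gt0.
  - by rewrite Ai poweRyr.
  by rewrite gt0_muley// gt0_mulye// leey.
have IE i : I i = (fine (I i))%:E.
  by rewrite fineK// ge0_fin_numE// ltey; apply/eqP => e; apply: Ifin; exists i.
have AE i : A i = (fine (A i))%:E.
  by rewrite fineK// gt0_fin_numE// ltey; apply/eqP => e; apply: Afin; exists i.
have KE : K = (fine K)%:E by rewrite fineK// gt0_fin_numE.
have I_gt0 i : 0 < fine (I i) by rewrite -lte_fin -IE.
have A_gt0 i : 0 < fine (A i) by rewrite -lte_fin -AE.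
have K_ge0 : 0 <= fine K by rewrite fine_ge0// ltW.
have := @frac_maximal_bound _ _ _ _ _ _ _ _ _ n0 m0 P1 pE qE p0 pq alpha_mn wA mf
  _ _ I_gt0 IE AE.
rewrite /norm_bound -/K => bound; rewrite /wnorm.
have -> : (C%:E * K `^ q^-1 * \prod_(i < m) A i `^ (P i)^-1 *
    \prod_(i < m) I i `^ (P i)^-1)%E =
    ((c * (fine K * \prod_(i < m) (fine (I i) / (D i * (2 * fine (A i))^-1)) `^ (q / P i)))
      `^ q^-1)%:E.
  rewrite norm_bound_root ?(ltW c0)// !EFinM -!prodEFin -/C {1}KE.
  congr (_ * _ * _ * _)%E; apply: eq_bigr => i _.
    by rewrite {1}AE.
  by rewrite {1}IE.
rewrite -poweR_EFin; apply: gt0_ler_poweR.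
- exact: ltW.
- rewrite in_itv/= leey andbT; apply: integral_ge0 => x _.
  by apply: mule_ge0; [exact: poweR_ge0|rewrite lee_fin powR_ge0].
- rewrite in_itv/= leey andbT lee_fin; apply: mulr_ge0; first exact: ltW.
  by apply: mulr_ge0 => //; apply: prodr_ge0 => i _; exact: powR_ge0.
by rewrite /c -mulrA.
Qed.
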